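(* Let $J,K\ge 1$ be integers, let $P=(p_{j,k})_{0\le j\le J,\,0\le k\le K}$ and $Q=(q_{k,j})_{1\le k\le K,\,1\le j\le J}$ be probability distributions satisfying the consistency conditions (C1) and (C2) of the context, and let $\delta\in(1/2,1)$ be fixed. For each admissible $N$, consider the erased configuration graph on the nodes $\{1,\dots,N\}$, i.e. the simple directed graph obtained by erasing all self-loops and multiple edges from the random directed graph generated by the algorithm described in the context. All node- and edge-types below refer to in- and out-degrees in the erased configuration graph. Then the following hold. (i) For every fixed $s\in\mathbb{N}$, the types $\big((j_{v_1},k_{v_1}),\ldots,(j_{v_s},k_{v_s})\big)$ of $s$ randomly chosen nodes of the erased configuration graph converge in distribution, as $N\to\infty$, to $s$ independent random variables each having distribution $P$; and the types of $s$ randomly chosen edges of the erased configuration graph converge in distribution, as $N\to\infty$, to $s$ independent random variables each having distribution $Q$. (ii) Let $\mathcal{V}^e_{j,k}$ be the number of nodes of type $(j,k)$, $\mathcal{E}^e_{k,j}$ the number of edges of type $(k,j)$, and $\mathcal{E}^e$ the total number of edges of the erased configuration graph. Then for any $\varepsilon>0$, $$\lim_{N\to\infty}\mathbb{P}\left[\sum_{j\in[J]_0,\,k\in[K]_0}\left|\frac{\mathcal{V}^e_{j,k}}{N}-p_{j,k}\right|+\sum_{k\in[K]_1,\,j\in[J]_1}\left|\frac{\mathcal{E}^e_{k,j}}{\mathcal{E}^e}-q_{k,j}\right|>\varepsilon\right]=0.$$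
   Context: Notation. For integers $0\le l\le n$ write $[n]_l=\{l,\ldots,n\}$; $\lceil x\rceil$ is the smallest integer $\ge x$. Graphs are directed and, before erasure, may contain self-loops and multiple edges. A node $v$ is of type $(j,k)$ if its in-degree is $j$ and its out-degree is $k$. A directed edge $e=\langle v,w\rangle$ (from $v$ to $w$) is of type $(k,j)$ if the out-degree of $v$ is $k$ and the in-degree of $w$ is $j$. Distributions. $P=(p_{j,k})_{j\in[J]_0,k\in[K]_0}$ and $Q=(q_{k,j})_{k\in[K]_1,j\in[J]_1}$ are probability distributions with marginals $p_j^-=\sum_{k'\in[K]_0}p_{j,k'}$, $p_k^+=\sum_{j'\in[J]_0}p_{j',k}$, $q_k^+=\sum_{j'\in[J]_1}q_{k,j'}$, $q_j^-=\sum_{k'\in[K]_1}q_{k',j}$. With $z=\sum_{k\in[K]_0}kp_k^+$, assumed $>0$, the consistency conditions are: (C1) $q_k^+=kp_k^+/z$ for all $k\in[K]_1$; (C2) $q_j^-=jp_j^-/z$ for all $j\in[J]_1$. Algorithm. Fix $\delta\in(1/2,1)$. $N\in\mathbb{N}$ is admissible if there is $N'\in\mathbb{N}$, $N'\geq 1$, with $N=N'+2\lceil N^\delta\rceil+\max\{J^2,K^2\}$ (true for all large $N$); set $N''=N'+\lceil N^\delta\rceil$. Step 1. Assign to each node $v=1,\ldots,N'$ independently a type $(j_v,k_v)$ with distribution $P$. Generate edges $e=1,\ldots,\lceil zN''\rceil$ with independent types $(k_e,j_e)$ with distribution $Q$, independently of the node-types. For $k\in[K]_1$ and $j\in[J]_1$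 put $n_k^+=\sum_{v=1}^{N'}1_{\{k_v=k\}}$, $e_k^+=\big\lceil\frac1k\sum_{e=1}^{\lceil zN''\rceil}1_{\{k_e=k\}}\big\rceil$, $n_j^-=\sum_{v=1}^{N'}1_{\{j_v=j\}}$, $e_j^-=\big\lceil\frac1j\sum_{e=1}^{\lceil zN''\rceil}1_{\{j_e=j\}}\big\rceil$. Let $A_N$ be the event that $|n_k^+-p_k^+N'|\le p_k^+N^\delta/2$ and $|e_k^+-p_k^+N''|\le p_k^+N^\delta/2$ for all $k\in[K]_1$, and $|n_j^--p_j^-N'|\le p_j^-N^\delta/2$ and $|e_j^--p_j^-N''|\le p_j^-N^\delta/2$ for all $j\in[J]_1$. If $A_N$ occurs go to Step 2, otherwise go to Step 5. Step 2. For each $k\in[K]_1$ add $r_k^+=ke_k^+-\sum_{e=1}^{\lceil zN''\rceil}1_{\{k_e=k\}}$ edges of type $(k,1)$; for each $j\in[J]_1$ add $r_j^-=je_j^--\sum_{e=1}^{\lceil zN''\rceil}1_{\{j_e=j\}}$ edges of type $(1,j)$. Set $r^+=\sum_{k\in[K]_1}r_k^+$, $r^-=\sum_{j\in[J]_1}r_j^-$. Step 3. Set the type of each node in $\{N'+1,\ldots,N\}$ to $(0,0)$. Successively for each $k\in[K]_1$, take the first $e_k^+-n_k^++r^-1_{\{k=1\}}$ nodes in $\{N'+1,\ldots,N\}$ having out-degree $0$ and change their out-degrees to $k$. Successively for each $j\in[J]_1$, take the first $e_j^--n_j^-+r^+1_{\{j=1\}}$ nodes in $\{N'+1,\ldots,N\}$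 having in-degree $0$ and change their in-degrees to $j$. (On $A_N$ these numbers are nonnegative and enough nodes are available.) Step 4. For each $k\in[K]_1$, assign to each node of out-degree $k$ exactly $k$ uniformly chosen edges $e$ with $k_e=k$ (as edges leaving that node); for each $j\in[J]_1$, assign to each node of in-degree $j$ exactly $j$ uniformly chosen edges $e$ with $j_e=j$ (as edges arriving at that node). Each edge is used exactly once at each end (the numbers match exactly), so these assignments are uniformly random allocations, made independently for the different $k$ and $j$ given the types. Go to Step 6. Step 5. Set node-types $(j_1,k_1)=(0,1)$, $(j_2,k_2)=(1,0)$, $(j_v,k_v)=(0,0)$ for $v=3,\ldots,N$, and insert the single edge $\langle1,2\rangle$. Step 6. Return the constructed graph. Erasure. All self-loops are deleted, and for each ordered pair $(v,w)$, $v\ne w$, with two or more edges from $v$ to $w$, all but one of these edges are deleted. Conventions. ''$s$ randomly chosen nodes (edges)'' means $s$ nodes (edges) each chosen uniformly from all nodes (edges) of the graph, independently of each other given the graph, and with the choice of nodes independent of the graph. If $\mathcal{E}^e=0$, the type of a randomly chosen edge is defined to be $(1,1)$, and the ratio $\mathcal{E}^e_{k,j}/\mathcal{E}^e$ is read as $0$. Limits $N\to\infty$ are along admissible $N$. *)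

(* Defs.v *)
From HB Require Import structures.
From mathcomp Require Import all_boot all_order all_algebra.
From mathcomp Require Import all_classical all_reals all_analysis.

Set Implicit Arguments.
Unset Strict Implicit.
Unset Printing Implicit Defensive.

Import Order.TTheory GRing.Theory Num.Theory.
Import numFieldNormedType.Exports.

Local Open Scope ring_scope.

(* Finite probability: a law on a finite type is given by its mass function.  *)
Section FiniteLaws.
Context {R : realType}.

Definition is_dist (T : finType) (mu : T -> R) : Prop :=
  (forall x, 0 <= mu x) /\ \sum_x mu x = 1.

Definition ret (T : finType) (x : T) : T -> R := fun y => (y == x)%:R.

Definition bind (T U : finType) (mu : T -> R) (nu : T -> U -> R) : U -> R :=
  fun y => \sum_x mu x * nu x y.

(* Law of a pair whose first component has law mu and whose second component
   has conditional law nu x given that the first is x. *)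
Definition joint (T U : finType) (mu : T -> R) (nu : T -> U -> R)
  : T * U -> R := fun xy => mu xy.1 * nu xy.1 xy.2.

(* Meaningful for nonempty A only. *)
Definition uniform (T : finType) (A : {set T}) : T -> R :=
  fun x => (x \in A)%:R / #|A|%:R.

Definition iid (T : finType) (n : nat) (mu : T -> R) : {ffun 'I_n -> T} -> R :=
  fun f => \prod_(i < n) mu (f i).
Arguments iid {T} n mu f.

Definition prob (T : finType) (mu : T -> R) (A : pred T) : R :=
  \sum_(x | A x) mu x.

Definition expect (T : finType) (mu : T -> R) (f : T -> R) : R :=
  \sum_x mu x * f x.

(* Random variables X n, on finite probability spaces (Omega n, mu n), converge
   in distribution along the filter F to Y, on (Omega', lam). *)
Definition cvg_in_distribution (S : topologicalType) (F : set_system nat)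
    (Omega : nat -> finType) (mu : forall n, Omega n -> R)
    (X : forall n, Omega n -> S)
    (Omega' : finType) (lam : Omega' -> R) (Y : Omega' -> S) : Prop :=
  forall f : S -> R, continuous f -> (exists M : R, forall x, `|f x| <= M) ->
    (expect (mu n) (fun w => f (X n w)) @[n --> F]
      --> expect lam (fun w => f (Y w)))%classic.

Definition natceil (x : R) : nat := `|Num.ceil x|%N.

End FiniteLaws.

Arguments iid {R T} n mu f.

(* P j k is p_{j,k} (0 <= j <= J, 0 <= k <= K) and Q k j is q_{k,j}
   (1 <= k <= K, 1 <= j <= J); values outside these ranges are never used. *)
Section Marginals.
Context {R : realType}.
Variables (J K : nat) (P Q : nat -> nat -> R).

Definition node_pmf : 'I_J.+1 * 'I_K.+1 -> R := fun x => P x.1 x.2.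
(* The element (k, j) of 'I_K * 'I_J stands for the type (k.+1, j.+1). *)
Definition edge_pmf : 'I_K * 'I_J -> R := fun x => Q x.1.+1 x.2.+1.

Definition p_in (j : nat) : R := \sum_(0 <= k < K.+1) P j k.
Definition p_out (k : nat) : R := \sum_(0 <= j < J.+1) P j k.
Definition q_out (k : nat) : R := \sum_(1 <= j < J.+1) Q k j.
Definition q_in (j : nat) : R := \sum_(1 <= k < K.+1) Q k j.

Definition mean_deg : R := \sum_(0 <= k < K.+1) k%:R * p_out k.

End Marginals.

(* A multigraph on N nodes is a list of directed edges; a simple digraph is a
   set of them.  Nodes 1, ..., N are numbered from 0. *)
Section Digraphs.
Variable N : nat.

Definition multigraph := seq ('I_N * 'I_N).
Definition digraph := {set 'I_N * 'I_N}.

Definition erase (g : multigraph) : digraph := [set e in g | e.1 != e.2].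

Definition indeg (g : digraph) (v : 'I_N) : nat :=
  #|[set w | (w, v) \in g]|.
Definition outdeg (g : digraph) (v : 'I_N) : nat :=
  #|[set w | (v, w) \in g]|.

Definition node_type (g : digraph) (v : 'I_N) : nat * nat :=
  (indeg g v, outdeg g v).
Definition edge_type (g : digraph) (e : 'I_N * 'I_N) : nat * nat :=
  (outdeg g e.1, indeg g e.2).

Definition num_nodes (g : digraph) (j k : nat) : nat :=
  #|[set v | node_type g v == (j, k)]|.
Definition num_edges (g : digraph) (k j : nat) : nat :=
  #|[set e in g | edge_type g e == (k, j)]|.

End Digraphs.

Section Algorithm.
Context {R : realType}.
Variables (J K : nat) (P Q : nat -> nat -> R) (delta : R).

Definition slack (N : nat) : nat := natceil (N%:R `^ delta).

Definition admissible (N : nat) : Prop :=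
  exists N' : nat,
    (1 <= N')%N /\ N = (N' + 2 * slack N + maxn (J ^ 2) (K ^ 2))%N.

(* For admissible N, size1 N is the unique N' above: N' nodes and num_init N
   edges get random types, the other N - N' nodes are kept in reserve to make
   the degrees match. *)
Definition size1 (N : nat) : nat :=
  (N - (2 * slack N + maxn (J ^ 2) (K ^ 2)))%N.
Definition size2 (N : nat) : nat := (size1 N + slack N)%N.
Definition num_init (N : nat) : nat :=
  natceil (mean_deg J K P * (size2 N)%:R).

(* One side (in or out) at a time: nd lists the degrees of the first N' nodes,
   ed the corresponding components of the types of the initial edges, and D is
   the maximal degree.  [demand ed k] is the number of nodes of degree k needed
   to use up the edges of label k, after [deficit ed k] edges are added so that
   their number is a multiple of k. *)
Definition demand (ed : seq nat) (k : nat) : nat :=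
  natceil (k%:R^-1 * (count_mem k ed)%:R : R).
Definition deficit (ed : seq nat) (k : nat) : nat :=
  (k * demand ed k - count_mem k ed)%N.
Definition total_deficit (D : nat) (ed : seq nat) : nat :=
  (\sum_(1 <= k < D.+1) deficit ed k)%N.

Definition balanced (N D : nat) (p : nat -> R) (nd ed : seq nat) : bool :=
  all (fun k =>
      (`|(count_mem k nd)%:R - p k * (size1 N)%:R|
          <= p k * N%:R `^ delta / 2)
   && (`|(demand ed k)%:R - p k * (size2 N)%:R|
          <= p k * N%:R `^ delta / 2))
    (iota 1 D).

(* Changes the first m zero entries of s into k. *)
Fixpoint assign_first (m k : nat) (s : seq nat) : seq nat :=
  match s, m with
  | 0%N :: s', m'.+1 => k :: assign_first m' k s'
  | d :: s', _ => d :: assign_first m k s'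
  | [::], _ => [::]
  end.

(* The degrees of all N nodes, the reserve nodes being used up to meet the
   demand.  The r edges added to make up the deficits of the opposite side have
   label 1 on this side, hence r more nodes of degree 1. *)
Definition complete_degrees (N D : nat) (nd ed : seq nat) (r : nat)
  : seq nat :=
  nd ++ foldl
    (fun s k => assign_first
      (demand ed k - count_mem k nd + (if k == 1 then r else 0))%N k s)
    (nseq (N - size1 N) 0%N) (iota 1 D).

(* The types (k, j) of the initial and the added edges. *)
Definition complete_edges (et : seq (nat * nat)) : seq (nat * nat) :=
  et
  ++ flatten [seq nseq (deficit (unzip1 et) k) (k, 1%N) | k <- iota 1 K]
  ++ flatten [seq nseq (deficit (unzip2 et) j) (1%N, j) | j <- iota 1 J].

(* Allocations at one end: edge e, whose type has component nth 0 lab e there,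
   is attached to a node of that degree, and a node of degree d receives
   exactly d edges.  A uniform element of this set amounts to independent
   uniform allocations for the different degrees. *)
Definition allocations (N m : nat) (deg lab : seq nat)
  : {set {ffun 'I_m -> 'I_N}} :=
  [set a : {ffun 'I_m -> 'I_N} |
     [forall e, nth 0%N deg (a e) == nth 0%N lab e]
  && [forall v : 'I_N, #|[set e | a e == v]| == nth 0%N deg v]].

(* The law of the erased graph given the types (j, k) of the first N' nodes and
   the types (k, j) of the initial edges, when these are balanced. *)
Definition match_law (N : nat) (nt et : seq (nat * nat)) : digraph N -> R :=
  let outs := complete_degrees N K (unzip2 nt) (unzip1 et)
                (total_deficit J (unzip2 et)) in
  let ins := complete_degrees N J (unzip1 nt) (unzip2 et)
               (total_deficit K (unzip1 et)) in
  let ets := complete_edges et in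
  bind (uniform (allocations N (size ets) outs (unzip1 ets))) (fun src =>
  bind (uniform (allocations N (size ets) ins (unzip2 ets))) (fun tgt =>
  ret (erase [seq (src e, tgt e) | e <- enum 'I_(size ets)]))).

(* The graph returned when the types are not balanced: a single edge, from the
   first node to the second. *)
Definition fallback (N : nat) : multigraph N :=
  [seq e : 'I_N * 'I_N <- enum {: 'I_N * 'I_N}
     | (e.1 == 0%N :> nat) && (e.2 == 1%N :> nat)].

Definition erased_law (N : nat) : digraph N -> R :=
  bind (iid (size1 N) (@node_pmf R J K P)) (fun t =>
  bind (iid (num_init N) (@edge_pmf R J K Q)) (fun u =>
    let nt := [seq ((t v).1 : nat, (t v).2 : nat) | v <- enum 'I_(size1 N)] in
    let et := [seq ((u e).1.+1, (u e).2.+1) | e <- enum 'I_(num_init N)] in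
    if balanced N K (p_out J P) (unzip2 nt) (unzip1 et)
    && balanced N J (p_in K P) (unzip1 nt) (unzip2 et)
    then match_law nt et
    else ret (erase (fallback N)))).

Definition admissible_oo : set_system nat :=
  within admissible (\oo)%classic.

(* A uniformly chosen edge; None if the graph has no edge, in which case
   the type is (1, 1) by convention. *)
Definition pick_edge (N : nat) (g : digraph N) : option ('I_N * 'I_N) -> R :=
  fun o => if o is Some e then uniform g e else (g == finset.set0)%:R.

Definition picked_type (N : nat) (g : digraph N) (o : option ('I_N * 'I_N))
  : nat * nat := if o is Some e then edge_type g e else (1%N, 1%N).

(* The graph together with s randomly chosen nodes, respectively edges. *)
Definition node_sample (N s : nat)
  : digraph N * {ffun 'I_s -> 'I_N} -> R :=
  joint (@erased_law N) (fun _ => iid s (uniform [set: 'I_N])).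
Definition edge_sample (N s : nat)
  : digraph N * {ffun 'I_s -> option ('I_N * 'I_N)} -> R :=
  joint (@erased_law N) (fun g => iid s (pick_edge g)).

End Algorithm.

(* s-tuples of types, with the (discrete) product topology. *)
Definition types (s : nat) : topologicalType :=
  prod_topology (fun _ : 'I_s => (nat * nat)%type).

(* Main.v *)
Require Import Defs.
From HB Require Import structures.
From mathcomp Require Import all_boot all_order all_algebra perm.
From mathcomp Require Import all_classical all_reals all_analysis.
From mathcomp Require Import ring lra zify.

(* Given the types, the two ends of the edges are independent uniform
   allocations.  Exchanging two equally labelled edges preserves the uniform
   law on the target allocations, so an edge of label j attaches to a given
   node of in-degree j with probability j / m_j, and shares its target with a
   given edge of the same label with probability (j - 1) / (m_j - 1), where m_j
   is the number of edges of label j.  Summing over the edges, the expected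
   number of edges that are loops or have a parallel copy is bounded by a
   constant depending on J and K only.  Each of them changes the types of
   boundedly many nodes and edges, and the nodes and edges that do not come
   from the independent initial types number O(N^delta); so, up to an event
   controlled by Markov's inequality, the type counts of the erased graph differ
   by O(N^delta) = o(N) from those of the initial types, and these concentrate
   at scale N^delta by Chebyshev's inequality, because delta > 1/2.  This is (ii).
   Given the graph, the sampled types are independent with law the empirical
   distribution of types, hence (i) follows from (ii). *)

Set Implicit Arguments.
Unset Strict Implicit.
Unset Printing Implicit Defensive.

Import Order.TTheory GRing.Theory Num.Theory.
Import numFieldNormedType.Exports.

Local Open Scope ring_scope.

(** * Finite laws and concentration *)

(** Since [uniform] of an empty set is the zero function, [match_law] is a law only once allocations
    exist at both ends. This is arithmetic on balanced types: the reserve must hold enough nodes,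
    and after completion every label [d] must be borne by exactly [d] times as many edges as there
    are nodes of degree [d].

    Deviations of the initial types are measured relative to the mass: [near_mean] allows an error
    [tau * mu x] at [x]. Such bounds add up to bounds by the marginals, which is the form of the
    event deciding whether the graph is built. Typical types are therefore balanced, and that event
    needs no probability estimate of its own.

    The scale [h = N ^ delta] also serves as threshold for the number of bad edges: it tends to
    infinity while the expected number stays bounded, and [h / N] tends to 0. Randomness thus enters
    at three places only, the node types, the edge types and the number of bad edges; everything
    between them is deterministic comparison. *)

Section Laws.
Context {R : realType}.

Lemma expect_bind (T U : finType) (mu : T -> R) (nu : T -> U -> R) (f : U -> R) :
  expect (bind mu nu) f = \sum_x mu x * expect (nu x) f.
Proof.
rewrite /expect /bind.
under eq_bigr do rewrite mulr_suml.
rewrite exchange_big /=; apply: eq_bigr => x _.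
by rewrite mulr_sumr; apply: eq_bigr => y _; rewrite mulrA.
Qed.

Lemma expect_ret (T : finType) (x : T) (f : T -> R) : expect (ret x) f = f x.
Proof.
rewrite /expect /ret (bigD1 x) //= eqxx mul1r big1 ?addr0 // => y /negPf yx.
by rewrite yx mul0r.
Qed.

Lemma expect_joint (T U : finType) (mu : T -> R) (nu : T -> U -> R)
    (f : T * U -> R) :
  expect (joint mu nu) f = \sum_x mu x * expect (nu x) (fun y => f (x, y)).
Proof.
rewrite /expect /joint.
rewrite (eq_bigr (fun x => mu x.1 * nu x.1 x.2 * f (x.1, x.2))); last by case.
rewrite -(pair_bigA _ (fun x y => mu x * nu x y * f (x, y))) /=.
by apply: eq_bigr => x _; rewrite mulr_sumr; apply: eq_bigr => y _; rewrite mulrA.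
Qed.

Lemma prob_expect (T : finType) (mu : T -> R) (A : pred T) :
  prob mu A = expect mu (fun x => (A x)%:R).
Proof. by rewrite /prob /expect big_mkcond; apply: eq_bigr => x _; case: (A x);
  rewrite ?mulr1 ?mulr0. Qed.

Lemma prob_bind (T U : finType) (mu : T -> R) (nu : T -> U -> R) (A : pred U) :
  prob (bind mu nu) A = \sum_x mu x * prob (nu x) A.
Proof. by rewrite prob_expect expect_bind; under eq_bigr do rewrite -prob_expect. Qed.

Lemma prob_ret (T : finType) (x : T) (A : pred T) : prob (ret x) A = (A x)%:R :> R.
Proof. by rewrite prob_expect expect_ret. Qed.

(** Only points of positive mass are compared, so an element drawn from [uniform A] may be assumed
    to lie in [A]. *)
Lemma ler_expect (T : finType) (mu : T -> R) (f g : T -> R) :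
  (forall x, 0 <= mu x) -> (forall x, mu x != 0 -> f x <= g x) ->
  expect mu f <= expect mu g.
Proof.
move=> mu0 fg; apply: ler_sum => x _.
by have [->|nz] := eqVneq (mu x) 0; [rewrite !mul0r | rewrite ler_wpM2l ?fg].
Qed.

Lemma expect_const (T : finType) (mu : T -> R) (c : R) :
  is_dist mu -> expect mu (fun=> c) = c.
Proof. by move=> [_ mu1]; rewrite /expect -mulr_suml mu1 mul1r. Qed.

Lemma prob_ge0 (T : finType) (mu : T -> R) (A : pred T) :
  is_dist mu -> 0 <= prob mu A.
Proof. by move=> [mu0 _]; apply: sumr_ge0. Qed.

Lemma prob_le1 (T : finType) (mu : T -> R) (A : pred T) :
  is_dist mu -> prob mu A <= 1.
Proof.
move=> mu_dist; rewrite prob_expect -[leRHS](expect_const 1 mu_dist).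
by apply: ler_expect => [|x _]; [case: mu_dist | case: (A x)].
Qed.

Lemma is_dist_bind (T U : finType) (mu : T -> R) (nu : T -> U -> R) :
  is_dist mu -> (forall x, mu x != 0 -> is_dist (nu x)) -> is_dist (bind mu nu).
Proof.
move=> [mu0 mu1] nuP; split=> [y|].
  apply: sumr_ge0 => x _.
  have [->|nz] := eqVneq (mu x) 0; first by rewrite mul0r.
  by rewrite mulr_ge0 //; case: (nuP x nz).
rewrite exchange_big /= -[RHS]mu1; apply: eq_bigr => x _; rewrite -mulr_sumr.
have [->|nz] := eqVneq (mu x) 0; first by rewrite mul0r.
by case: (nuP x nz) => _ ->; rewrite mulr1.
Qed.

Lemma is_dist_ret (T : finType) (x : T) : is_dist (ret x : T -> R).
Proof.
split=> [y|]; first exact: ler0n.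
have := expect_ret x (fun=> 1); rewrite /expect => <-.
by apply: eq_bigr => y _; rewrite mulr1.
Qed.

Lemma uniform_ge0 (T : finType) (A : {set T}) x : 0 <= uniform A x :> R.
Proof. by rewrite divr_ge0. Qed.

Lemma expect_uniform (T : finType) (A : {set T}) (f : T -> R) :
  expect (uniform A) f = (\sum_(x in A) f x) / #|A|%:R.
Proof.
rewrite mulr_suml [RHS]big_mkcond; apply: eq_bigr => x _; rewrite /uniform.
by case: (x \in A); rewrite ?mul0r // mul1r mulrC.
Qed.

Lemma expect_uniform_count (T : finType) (A : {set T}) (p : pred T) :
  expect (uniform A) (fun x => (p x)%:R) = #|[set x in A | p x]|%:R / #|A|%:R :> R.
Proof.
rewrite expect_uniform -natr_sum; congr (_%:R / _).
rewrite -sum1_card [RHS](eq_bigl (fun x => (x \in A) && p x)); last first.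
  by move=> x; rewrite inE.
by rewrite -big_mkcondr.
Qed.

Lemma is_dist_uniform (T : finType) (A : {set T}) :
  A != finset.set0 -> is_dist (uniform A : T -> R).
Proof.
move=> A0; split=> [x|]; first exact: uniform_ge0.
have := expect_uniform A (fun=> 1); rewrite /expect.
under eq_bigr do rewrite mulr1.
move=> ->; rewrite sumr_const mulfV //.
by rewrite pnatr_eq0 cards_eq0.
Qed.

Section Iid.
Variables (T : finType) (n : nat) (mu : T -> R).

Lemma expect_iid_prod (F : 'I_n -> T -> R) :
  expect (iid n mu) (fun f => \prod_i F i (f i)) = \prod_i expect mu (F i).
Proof.
rewrite /expect bigA_distr_bigA /=; apply: eq_bigr => f _.
by rewrite /iid -big_split.
Qed.

Hypothesis mu_dist : is_dist mu.

Lemma is_dist_iid : is_dist (iid n mu).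
Proof.
split=> [f|]; first by apply: prodr_ge0 => i _; case: mu_dist.
rewrite /iid -(bigA_distr_bigA (fun=> mu)) big1 // => i _; by case: mu_dist.
Qed.

Lemma expect_iid_cross (i j : 'I_n) (Y : T -> R) : expect mu Y = 0 ->
  expect (iid n mu) (fun f => Y (f i) * Y (f j))
    = (i == j)%:R * expect mu (fun x => Y x ^+ 2).
Proof.
move=> Y0.
(* Both factors are written as one product over all indices, so that independence applies whether or
   not [i = j]. *)
pose F l x := (if l == i then Y x else 1) * (if l == j then Y x else 1).
transitivity (expect (iid n mu) (fun f => \prod_l F l (f l))).
  apply: eq_bigr => f _; congr (_ * _); rewrite big_split /=.
  by rewrite -!big_mkcond !big_pred1_eq.
rewrite expect_iid_prod (bigD1 i) //=.
have [ij|ij] := eqVneq i j; last first.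
  rewrite mul0r [X in X * _](_ : _ = 0) ?mul0r // -[RHS]Y0.
  by apply: eq_bigr => x _; rewrite /F eqxx (negPf ij) mulr1.
rewrite mul1r big1 ?mulr1.
  by apply: eq_bigr => x _; rewrite /F -ij eqxx expr2.
move=> l /negPf li; rewrite -[RHS](expect_const 1 mu_dist).
by apply: eq_bigr => x _; rewrite /F -ij li mulr1.
Qed.

(** Covariances of distinct draws vanish and each draw has variance [mu x * (1 - mu x)]. Keeping the
    factor [mu x] makes the bound vanish at points of mass 0. *)
Lemma iid_variance (x : T) :
  expect (iid n mu) (fun f => (#|[set i | f i == x]|%:R - n%:R * mu x) ^+ 2)
    <= n%:R * mu x.
Proof.
pose Y y : R := (y == x)%:R - mu x.
have Y0 : expect mu Y = 0.
  rewrite /expect; under eq_bigr do rewrite mulrBr.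
  rewrite sumrB -mulr_suml; case: (mu_dist) => _ ->; rewrite mul1r.
  rewrite (bigD1 x) //= eqxx mulr1 big1 ?addr0 ?subrr // => y /negPf ->.
  by rewrite mulr0.
have -> : expect (iid n mu) (fun f => (#|[set i | f i == x]|%:R - n%:R * mu x) ^+ 2)
  = \sum_i \sum_j expect (iid n mu) (fun f => Y (f i) * Y (f j)).
  rewrite /expect; under [RHS]eq_bigr do rewrite exchange_big /=.
  rewrite exchange_big /=; apply: eq_bigr => f _.
  under [RHS]eq_bigr do rewrite -mulr_sumr.
  rewrite -mulr_sumr; congr (_ * _).
  under eq_bigr do rewrite -mulr_sumr.
  rewrite -mulr_suml -expr2; congr (_ ^+ 2).
  rewrite sumrB sumr_const card_ord mulr_natl; congr (_ - _).
  rewrite -sum1_card natr_sum big_mkcond /=; apply: eq_bigr => i _.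
  by rewrite inE; case: (f i == x).
have EY2 : expect mu (fun y => Y y ^+ 2) <= mu x.
  (* An indicator equals its square, so the square of [Y] is affine in it. *)
  rewrite /expect (eq_bigr (fun y => mu y * (1 - 2 * mu x) * (y == x)%:R + mu y * mu x ^+ 2)).
    rewrite big_split /= -mulr_suml; case: (mu_dist) => mu0 ->.
    rewrite (bigD1 x) //= eqxx big1 ?addr0; last by move=> y /negPf ->; rewrite mulr0.
    rewrite mulr1 mul1r -subr_ge0.
    rewrite [leRHS](_ : _ = mu x ^+ 2) ?sqr_ge0 //; ring.
  by move=> y _; rewrite /Y; case: eqVneq => [->|_] /=; ring.
apply: (@le_trans _ _ (\sum_(i < n) mu x)); last by rewrite sumr_const card_ord mulr_natl.
apply: ler_sum => i _.
under eq_bigr do rewrite expect_iid_cross //.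
rewrite (bigD1 i) //= eqxx mul1r big1 ?addr0 // => j; rewrite eq_sym => /negPf ->.
by rewrite mul0r.
Qed.

(* At [mu x = 0] the bound reads 0, by the convention [0^-1 = 0]. *)
Lemma iid_deviation (x : T) (tau : R) : 0 < tau ->
  prob (iid n mu) (fun f => tau * mu x < `|#|[set i | f i == x]|%:R - n%:R * mu x|)
    <= n%:R / tau ^+ 2 * (mu x)^-1.
Proof.
move=> tau0; have [iid0 _] := is_dist_iid; have [mu0 _] := mu_dist.
have := iid_variance x; set V := expect _ _ => V_le.
have [mux0|mux_neq0] := eqVneq (mu x) 0.
  rewrite mux0 invr0 !mulr0.
  have /eqP : V = 0.
    apply/eqP; rewrite eq_le; apply/andP; split; first by rewrite (le_trans V_le) // mux0 mulr0.
    by apply: sumr_ge0 => f _; rewrite mulr_ge0 ?sqr_ge0.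
  rewrite psumr_eq0; last by move=> f _; rewrite mulr_ge0 ?sqr_ge0.
  move=> /allP V0; rewrite /prob big1 // => f; rewrite normr_gt0 => f0.
  have := V0 f (mem_index_enum f); rewrite implyTb mulf_eq0 => /orP[/eqP //|].
  by rewrite sqrf_eq0 mux0 mulr0 (negPf f0).
have mux_gt0 : 0 < mu x by rewrite lt_neqAle eq_sym mux_neq0 mu0.
have tm : 0 < (tau * mu x) ^+ 2 by rewrite exprn_gt0 ?mulr_gt0.
apply: (@le_trans _ _ (V / (tau * mu x) ^+ 2)); last first.
  rewrite ler_pdivrMr // (le_trans V_le) //.
  rewrite (_ : n%:R / tau ^+ 2 / mu x * (tau * mu x) ^+ 2 = n%:R * mu x) //.
  by field; rewrite mux_neq0 lt0r_neq0.
rewrite prob_expect /V /expect mulr_suml; apply: ler_sum => f _; rewrite -mulrA.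
rewrite ler_wpM2l //; set d := _ - _.
have [big|_] := boolP (tau * mu x < `|d|); last by rewrite divr_ge0 ?sqr_ge0 // ltW.
rewrite ler_pdivlMr // mul1r -[leRHS]real_normK ?num_real // ler_sqr ?nnegrE ?normr_ge0
  ?mulr_ge0 ?ltW //.
Qed.

End Iid.
End Laws.

(** * Samples from nearby laws *)

Section Sampling.
Context {R : realType}.

(* Hybrid argument: change one factor at a time. *)
Lemma product_law_distance (T : finType) (s : nat) (a b : T -> R) (eps : R) :
  (forall x, 0 <= a x) -> (forall x, 0 <= b x) ->
  \sum_x a x <= 1 -> \sum_x b x <= 1 -> \sum_x `|a x - b x| <= eps ->
  \sum_y `|iid s a y - iid s b y| <= s%:R * eps.
Proof.
move=> a0 b0 a1 b1 ab.
pose H m (y : {ffun 'I_s -> T}) := \prod_(i < s) (if (i < m)%N then a (y i) else b (y i)).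
(* [H m] takes its first [m] factors from [a] and the others from [b]; [G m] gives the factors of
   the distance between the consecutive hybrids [H m] and [H m.+1]. *)
pose G (m i : 'I_s) x := if (i < m)%N then a x else if i == m then `|a x - b x| else b x.
have eps0 : 0 <= eps by apply: le_trans ab; apply: sumr_ge0.
have stepH (m : 'I_s) y : `|H m.+1 y - H m y| = \prod_i G m i (y i).
  rewrite /H (bigD1 m) //= [X in _ - X](bigD1 m) //= ltnSn ltnn.
  rewrite (eq_bigr (fun i : 'I_s => if (i < m)%N then a (y i) else b (y i))); last first.
    by move=> i im; rewrite ltnS leq_eqVlt val_eqE (negPf im).
  rewrite -mulrBl normrM [RHS](bigD1 m) //= {1}/G ltnn eqxx; congr (_ * _).
  rewrite ger0_norm; last by apply: prodr_ge0 => i _; case: ifP.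
  by apply: eq_bigr => i /negPf im; rewrite /G im.
have HE y : `|iid s a y - iid s b y| <= \sum_(m < s) `|H m.+1 y - H m y|.
  have -> : iid s a y = H s y by apply: eq_bigr => i _; rewrite ltn_ord.
  have -> : iid s b y = H 0%N y by apply: eq_bigr => i _.
  rewrite -(telescope_sumr (fun m => H m y) (leq0n s)) big_mkord.
  exact: ler_norm_sum.
apply: (le_trans (ler_sum _ (fun y _ => HE y))).
rewrite exchange_big /=.
apply: (@le_trans _ _ (\sum_(m < s) eps)); last by rewrite sumr_const card_ord mulr_natl.
apply: ler_sum => m _; under eq_bigr do rewrite stepH.
rewrite -(bigA_distr_bigA (G m)) /= (bigD1 m) //=.
rewrite -[leRHS]mulr1; apply: ler_pM.
- by apply: sumr_ge0 => x _; rewrite /G ltnn eqxx.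
- apply: prodr_ge0 => i _; apply: sumr_ge0 => x _.
  by rewrite /G; do 2?case: ifP.
- by under eq_bigr do rewrite /G ltnn eqxx.
apply: prodr_ile1 => i im; apply/andP; split.
  by apply: sumr_ge0 => x _; rewrite /G (negPf im); case: ifP.
under eq_bigr do rewrite /G (negPf im).
by case: (i < m)%N.
Qed.

(** The law of [X], seen on the values of [Y] only, may have mass below 1. The error has two parts,
    each at most [M * (s%:R * eps)]: the distance between the two product laws, and the probability
    that some coordinate leaves the image of [Y]. The latter is the mass that the first product
    lacks, hence is bounded by the same distance. *)
Lemma sample_distance (T T' : finType) (U : eqType) (s : nat)
    (nu : T -> R) (lam : T' -> R) (X : T -> U) (Y : T' -> U)
    (f : ('I_s -> U) -> R) (M eps : R) :
  is_dist nu -> is_dist lam -> injective Y -> 0 <= M -> (forall x, `|f x| <= M) ->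
  \sum_y `|prob nu (fun x => X x == Y y) - lam y| <= eps ->
  `|expect (iid s nu) (fun c => f (fun i => X (c i)))
    - expect (iid s lam) (fun c => f (fun i => Y (c i)))| <= 2 * M * (s%:R * eps).
Proof.
move=> nu_dist lam_dist Yinj M0 fM close.
pose a y := prob nu (fun x => X x == Y y).
pose match_all (c : {ffun 'I_s -> T}) (y : {ffun 'I_s -> T'}) : R :=
  \prod_i (X (c i) == Y (y i))%:R.
(* As [Y] is injective, at most one [y] matches all coordinates of [c]; so [missed c] is 1 if some
   [X (c i)] lies outside the image of [Y], and 0 otherwise. *)
pose missed c := 1 - \sum_y match_all c y.
have sum_hits u : \sum_y (u == Y y)%:R <= 1 :> R.
  have [y /eqP uy|none] := pickP (fun y => u == Y y); last first.
    by rewrite big1 ?ler01 // => y _; rewrite none.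
  rewrite (bigD1 y) //= uy eqxx big1 ?addr0 // => y' yy'.
  by rewrite (inj_eq Yinj) eq_sym (negPf yy').
have missed_ge0 c : 0 <= missed c.
  rewrite subr_ge0 /match_all.
  rewrite -(bigA_distr_bigA (fun i y => (X (c i) == Y y)%:R)) /=.
  by apply: prodr_ile1 => i _; rewrite sum_hits sumr_ge0.
have E_match y : expect (iid s nu) (match_all ^~ y) = iid s a y.
  rewrite (expect_iid_prod nu (fun i x => (X x == Y (y i))%:R)).
  by apply: eq_bigr => i _; rewrite /a prob_expect.
have [nus0 nus1] := is_dist_iid s nu_dist; have [lams0 lams1] := is_dist_iid s lam_dist.
have split_f : expect (iid s nu) (fun c => f (fun i => X (c i)))
   = \sum_y iid s a y * f (fun i => Y (y i))
     + expect (iid s nu) (fun c => missed c * f (fun i => X (c i))).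
  under [X in _ = X + _]eq_bigr do rewrite -E_match mulr_suml.
  rewrite exchange_big -big_split /=; apply: eq_bigr => c _.
  rewrite (eq_bigr (fun y => iid s nu c * f (fun i => X (c i)) * match_all c y)).
    by rewrite -mulr_sumr /missed; ring.
  move=> y _; rewrite -!mulrA; congr (_ * _); rewrite mulrC.
  rewrite /match_all; have [/forallP XY|/forallPn[i XYi]] := boolP [forall i, X (c i) == Y (y i)].
    congr (_ * _); congr f; apply/funext => i; by rewrite (eqP (XY i)).
  by rewrite (bigD1 i) //= (negPf XYi) !(mul0r, mulr0).
have a0 y : 0 <= a y by apply: prob_ge0.
have sum_a : \sum_y a y <= 1.
  rewrite /a; under eq_bigr do rewrite prob_expect; rewrite exchange_big /=.
  rewrite -[leRHS](expect_const 1 nu_dist); apply: ler_sum => x _.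
  by rewrite -mulr_sumr ler_wpM2l ?sum_hits //; case: nu_dist.
have [lam0 lam1] := lam_dist.
have := product_law_distance s a0 lam0 sum_a _ close; rewrite lam1 => /(_ (lexx _)) dist.
rewrite split_f addrAC [expect (iid s lam) _]/expect -sumrB.
rewrite (le_trans (ler_normD _ _)) //.
rewrite (_ : 2 * M * _ = M * (s%:R * eps) + M * (s%:R * eps)); last by ring.
apply: lerD.
  apply: le_trans (ler_norm_sum _ _ _) _.
  apply: (@le_trans _ _ (M * (\sum_y `|iid s a y - iid s lam y|))); last by rewrite ler_wpM2l.
  rewrite mulr_sumr; apply: ler_sum => y _.
  by rewrite -mulrBl normrM mulrC ler_wpM2r.
apply: (@le_trans _ _ (M * expect (iid s nu) missed)).
  apply: le_trans (ler_norm_sum _ _ _) _.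
  rewrite mulr_sumr; apply: ler_sum => c _.
  rewrite !normrM (ger0_norm (nus0 c)) (ger0_norm (missed_ge0 c)).
  by rewrite mulrA mulrC ler_wpM2r // mulr_ge0.
rewrite ler_wpM2l //; apply: le_trans dist.
rewrite /expect /missed.
under eq_bigr do rewrite mulrBr mulr1 mulr_sumr.
rewrite sumrB nus1 exchange_big /= -lams1 -sumrB; apply: ler_sum => y _.
have -> : \sum_i iid s nu i * match_all i y = iid s a y by rewrite -E_match.
by rewrite distrC ler_norm.
Qed.
End Sampling.

Section JointSampling.
Context {R : realType}.

(** Conditioning on the graph: [sample_distance] applies off [bad], the trivial bound [2 * M] on
    it. *)
Lemma joint_sample_distance (G T T' : finType) (U : eqType) (s : nat)
    (law : G -> R) (nu : G -> T -> R) (lam : T' -> R) (X : G -> T -> U) (Y : T' -> U)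
    (f : ('I_s -> U) -> R) (M eps : R) (bad : pred G) :
  is_dist law -> (forall g, is_dist (nu g)) -> is_dist lam -> injective Y ->
  0 <= M -> (forall x, `|f x| <= M) -> 0 <= eps ->
  (forall g, ~~ bad g ->
     \sum_y `|prob (nu g) (fun x => X g x == Y y) - lam y| <= eps) ->
  `|expect (joint law (fun g => iid s (nu g))) (fun w => f (fun i => X w.1 (w.2 i)))
    - expect (iid s lam) (fun c => f (fun i => Y (c i)))|
    <= 2 * M * (s%:R * eps) + 2 * M * prob law bad.
Proof.
move=> law_dist nu_dist lam_dist Yinj M0 fM eps0 close.
have [law0 law1] := law_dist.
set L := expect (iid s lam) _.
have bounded (S : finType) (mu : S -> R) (F : S -> R) : is_dist mu ->
    (forall x, `|F x| <= M) -> `|expect mu F| <= M.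
  move=> mu_dist FM; have [mu0 _] := mu_dist.
  apply: le_trans (ler_norm_sum _ _ _) _; rewrite -[leRHS](expect_const M mu_dist).
  by apply: ler_sum => x _; rewrite normrM (ger0_norm (mu0 x)) ler_wpM2l.
rewrite expect_joint -(expect_const L law_dist) -sumrB.
apply: le_trans (ler_norm_sum _ _ _) _.
rewrite prob_expect -(expect_const (2 * M * (s%:R * eps)) law_dist) [in leRHS]/expect.
rewrite mulr_sumr -big_split; apply: ler_sum => g _ /=.
rewrite -mulrBr normrM (ger0_norm (law0 g)) [2 * M * (law g * _)]mulrCA -mulrDr ler_wpM2l //.
have [bg|/close cg] := boolP (bad g).
  rewrite mulr1 -[leLHS]add0r lerD //; first by rewrite !mulr_ge0.
  apply: le_trans (ler_normB _ _) _; rewrite mulr_natl mulr2n lerD // bounded //.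
    exact: is_dist_iid.
  exact: is_dist_iid.
by rewrite mulr0 addr0; apply: (sample_distance (f := f) (X := X g)).
Qed.
End JointSampling.

(** * Exchangeability of allocations *)

(* Every copy of a multiple edge counts as bad, including the one that
   survives the erasure. *)
Definition bad_edges (N m : nat) (src tgt : {ffun 'I_m -> 'I_N}) : {set 'I_m} :=
  [set e | (src e == tgt e)
    || [exists e', [&& e' != e, src e' == src e & tgt e' == tgt e]]].

Section Allocations.
Variables (N m : nat) (deg lab : seq nat).
Local Notation A := (allocations N m deg lab).
Local Notation label e := (nth 0%N lab (e : 'I_m)).

Definition label_count (d : nat) : nat := #|[set e : 'I_m | label e == d]|.

Lemma allocations_deg (a : {ffun 'I_m -> 'I_N}) e :
  a \in A -> nth 0%N deg (a e) = label e.
Proof. by rewrite inE => /andP[/forallP/(_ e)/eqP]. Qed.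

Lemma allocations_card (a : {ffun 'I_m -> 'I_N}) v :
  a \in A -> #|[set e | a e == v]| = nth 0%N deg v.
Proof. by rewrite inE => /andP[_ /forallP/(_ v)/eqP]. Qed.

Definition swap_edges (e1 e2 : 'I_m) (a : {ffun 'I_m -> 'I_N}) :
  {ffun 'I_m -> 'I_N} := [ffun e => a (tperm e1 e2 e)].

Lemma swap_edgesE e1 e2 a e : swap_edges e1 e2 a e = a (tperm e1 e2 e).
Proof. exact: ffunE. Qed.

Lemma swap_edgesK e1 e2 : involutive (swap_edges e1 e2).
Proof. by move=> a; apply/ffunP => e; rewrite !swap_edgesE tpermK. Qed.

Lemma swap_edges_allocations e1 e2 a : label e1 = label e2 ->
  (swap_edges e1 e2 a \in A) = (a \in A).
Proof.
move=> lab12.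
suff imp b : b \in A -> swap_edges e1 e2 b \in A.
  by apply/idP/idP => [/imp|/imp //]; rewrite swap_edgesK.
move=> bA; rewrite inE; apply/andP; split; apply/forallP.
  move=> e; rewrite swap_edgesE (allocations_deg _ bA).
  by case: tpermP => [->|->|//]; rewrite ?lab12.
move=> v; rewrite -(allocations_card v bA).
rewrite -(card_imset _ (@perm_inj _ (tperm e1 e2))); apply/eqP/eq_card => e.
apply/imsetP/idP => [[e']|]; rewrite inE.
  by rewrite inE swap_edgesE => be' ->.
by move=> be; exists (tperm e1 e2 e); rewrite ?tpermK // inE swap_edgesE tpermK.
Qed.

(* By symmetry under exchange of equally labelled edges, the average of an event
   about one such edge can be computed by counting the edges for which it holds. *)
Lemma card_alloc_at (e : 'I_m) (v : 'I_N) :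
  (#|[set a in A | a e == v]| * label_count (label e) <= label e * #|A|)%N.
Proof.
have sym e' : label e' == label e ->
    #|[set a in A | a e' == v]| = #|[set a in A | a e == v]|.
  move=> /eqP lab_e; rewrite -(card_imset _ (inv_inj (swap_edgesK e e'))).
  apply: eq_card => a; rewrite [RHS]inE; apply/imsetP/idP => [[b]|].
    by rewrite inE => /andP[bA bv] ->; rewrite swap_edges_allocations // bA swap_edgesE tpermL.
  move=> /andP[aA av]; exists (swap_edges e e' a); last by rewrite swap_edgesK.
  by rewrite inE swap_edges_allocations // aA swap_edgesE tpermR.
rewrite mulnC -sum_nat_const [leqRHS]mulnC -sum_nat_const.
rewrite (eq_bigr (fun e' => \sum_(a in A) (a e' == v))%N); last first.
  move=> e'; rewrite inE => /sym <-; rewrite -sum1_card.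
  rewrite (eq_bigl (fun a => (a \in A) && (a e' == v))); last by move=> a; rewrite inE.
  by rewrite big_mkcondr.
rewrite exchange_big /=; apply: leq_sum => a aA.
(* In one allocation all edges at [v] are labelled by its degree, and there are as many of them as
   this degree: exactly [label e] if it equals [label e], otherwise none of the label of [e]. *)
have [/eqP ev|ev] := eqVneq (nth 0%N deg v) (label e).
  rewrite -(eqP ev) -(allocations_card v aA) -sum1_card [leqRHS]big_mkcond /=.
  rewrite [leqLHS]big_mkcond /=; apply: leq_sum => e' _.
  by rewrite !inE; case: ifP => // _; case: (a e' == v).
rewrite big1 // => e'; rewrite inE => /eqP le'; apply/eqP; rewrite eqb0.
by apply/eqP => av; case/eqP: ev; rewrite -av -le' (allocations_deg _ aA).
Qed.

(** Exchanging [e'] with another edge of the same label fixes [e], so all rivals of [e] with its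
    label share its node equally often, and in one allocation at most [label e] of them do. Edges of
    different labels never meet, the label being the degree of the node. *)
Lemma card_alloc_pair (e e' : 'I_m) : e' != e ->
  (#|[set a in A | a e' == a e]| * (label_count (label e)).-1 <= label e * #|A|)%N.
Proof.
move=> e'e.
have [le'|le'] := eqVneq (label e') (label e); last first.
  rewrite (_ : [set _ in A | _] = finset.set0) ?cards0 //; apply/setP => a;
    rewrite [LHS]inE [RHS]inE.
  apply/negbTE; rewrite negb_and -implybE; apply/implyP => aA.
  by apply: contraNneq le' => ae; rewrite -!(allocations_deg _ aA) ae.
have sym e2 : label e2 == label e -> e2 != e ->
    #|[set a in A | a e2 == a e]| = #|[set a in A | a e' == a e]|.
  move=> /eqP lab_e e2e; rewrite -(card_imset _ (inv_inj (swap_edgesK e' e2))).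
  have lab2 : label e' = label e2 by rewrite le'.
  apply: eq_card => a; rewrite [RHS]inE; apply/imsetP/idP => [[b]|].
    rewrite inE => /andP[bA bv] ->; rewrite swap_edges_allocations // bA !swap_edgesE tpermL.
    by rewrite tpermD.
  move=> /andP[aA av]; exists (swap_edges e' e2 a); last by rewrite swap_edgesK.
  by rewrite inE swap_edges_allocations // aA !swap_edgesE tpermR tpermD.
have -> : (label_count (label e)).-1 = #|[set e2 | label e2 == label e] :\ e|.
  by rewrite /label_count (cardsD1 e) inE eqxx.
rewrite mulnC -sum_nat_const [leqRHS]mulnC -sum_nat_const.
rewrite (eq_bigr (fun e2 => \sum_(a in A) (a e2 == a e))%N); last first.
  move=> e2; rewrite !inE => /andP[e2e /sym <- //]; rewrite -sum1_card.
  rewrite (eq_bigl (fun a => (a \in A) && (a e2 == a e))); last by move=> a; rewrite inE.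
  by rewrite big_mkcondr.
rewrite exchange_big /=; apply: leq_sum => a aA.
rewrite -(allocations_deg _ aA) -(allocations_card _ aA) -sum1_card [leqRHS]big_mkcond /=.
rewrite [leqLHS]big_mkcond /=; apply: leq_sum => e2 _.
by rewrite !inE; case: ifP => // _; case: (a e2 == a e).
Qed.

Section Expectation.
Context {R : realType}.

Definition label_weight (e : 'I_m) : R := (label e)%:R / (label_count (label e))%:R.

Lemma label_count_gt0 e : (0 < label_count (label e))%N.
Proof. by apply/card_gt0P; exists e; rewrite inE. Qed.

(** Each of the labels 0 to [D] contributes at most [D], however many edges bear it; so the bound
    does not grow with the number of edges. *)
Lemma sum_label_weight (D : nat) : (forall e : 'I_m, label e <= D)%N ->
  \sum_e label_weight e <= (D * D.+1)%:R.
Proof.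
move=> labD.
rewrite (partition_big (fun e : 'I_m => inord (label e) : 'I_D.+1) xpredT) //=.
apply: (@le_trans _ _ (\sum_(d < D.+1) D%:R)); last first.
  by rewrite sumr_const card_ord natrM mulr_natr.
apply: ler_sum => d _.
rewrite (eq_bigl (fun e => e \in [set e : 'I_m | label e == d])); last first.
  by move=> e; rewrite inE -val_eqE /= inordK // ltnS.
rewrite (eq_bigr (fun=> d%:R / (label_count d)%:R)); last first.
  by move=> e; rewrite inE /label_weight => /eqP ->.
rewrite sumr_const -[#|_|]/(label_count d) -[leLHS]mulr_natr.
have [->|c0] := eqVneq (label_count d) 0%N; first by rewrite mulr0.
by rewrite divfK ?pnatr_eq0 // ler_nat -ltnS.
Qed.

Lemma prob_alloc_at (e : 'I_m) (v : 'I_N) :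
  expect (uniform A) (fun a : {ffun 'I_m -> 'I_N} => (a e == v)%:R) <= label_weight e.
Proof.
rewrite expect_uniform_count.
have [->|A0] := posnP #|A|; first by rewrite invr0 mulr0 divr_ge0.
rewrite ler_pdivrMr ?ltr0n // mulrAC ler_pdivlMr ?ltr0n ?label_count_gt0 //.
by rewrite -!natrM ler_nat card_alloc_at.
Qed.

(** The factor 2 replaces [c - 1] by [c] in the denominator, which is possible for [c >= 2]. If [e]
    is alone with its label, it shares its node with no other edge. *)
Lemma prob_alloc_pair (e e' : 'I_m) : e' != e ->
  expect (uniform A) (fun a : {ffun 'I_m -> 'I_N} => (a e' == a e)%:R)
    <= 2 * label_weight e.
Proof.
move=> e'e; rewrite expect_uniform_count.
have [->|A0] := posnP #|A|; first by rewrite invr0 mulr0 mulr_ge0 // divr_ge0.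
rewrite mulrA ler_pdivrMr ?ltr0n // mulrAC ler_pdivlMr ?ltr0n ?label_count_gt0 //.
rewrite -!natrM ler_nat.
have [c1|c2] := leqP (label_count (label e)) 1.
  rewrite (_ : [set _ in A | _] = finset.set0) ?cards0 //; apply/setP => a;
    rewrite [LHS]inE [RHS]inE.
  apply/negbTE; rewrite negb_and -implybE; apply/implyP => aA.
  apply: contraTneq c1 => ae; rewrite -ltnNge.
  apply: (@leq_trans #|[set e; e']|); first by rewrite cards2 eq_sym e'e.
  apply: subset_leq_card; apply/fintype.subsetP => e2; rewrite !inE => /orP[/eqP -> //|/eqP ->].
  by rewrite -!(allocations_deg _ aA) ae.
have := card_alloc_pair e'e; case: (label_count _) c2 => // [[//|c]] _ /=.
by move: #|_| => x; move: #|_| => y; nia.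
Qed.

(* Averaging over the targets alone is enough: an edge has at most [D1] rivals
   with the same source, and the weights [d / label_count d] of the edges of
   label [d] add up to [d]. *)
Lemma expect_bad_edges (D1 D2 : nat) (src : {ffun 'I_m -> 'I_N}) :
  (forall v, #|[set e | src e == v]| <= D1)%N ->
  (forall e : 'I_m, label e <= D2)%N ->
  expect (uniform A) (fun tgt => #|bad_edges src tgt|%:R)
    <= ((1 + 2 * D1) * (D2 * D2.+1))%:R :> R.
Proof.
move=> srcD1 labD2.
(* Union bound: a bad [e] is a loop or has a parallel [e'] among the edges with its source. *)
apply: (@le_trans _ _ (expect (uniform A) (fun tgt => \sum_e ((tgt e == src e)%:R +
    \sum_(e' | (e' != e) && (src e' == src e)) (tgt e' == tgt e)%:R)))).
  apply: ler_expect => [tgt|tgt _]; first exact: uniform_ge0.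
  rewrite -sum1_card natr_sum big_mkcond /=; apply: ler_sum => e _.
  rewrite inE eq_sym; case: (tgt e == src e) => /=.
    by rewrite lerDl sumr_ge0.
  rewrite add0r; case: existsP => [[e' /and3P[e'e se' te']]|_]; last exact: sumr_ge0.
  by rewrite (bigD1 e') ?e'e //= te' lerDl sumr_ge0.
rewrite /expect; under eq_bigr do rewrite mulr_sumr.
rewrite exchange_big /=.
apply: (@le_trans _ _ (\sum_e (1 + 2 * D1)%:R * label_weight e)); last first.
  by rewrite -mulr_sumr natrM ler_wpM2l // sum_label_weight.
apply: ler_sum => e _; under eq_bigr do rewrite mulrDr mulr_sumr.
rewrite big_split /= natrD mulrDl mul1r lerD ?prob_alloc_at //.
rewrite exchange_big /=.
apply: (@le_trans _ _ (\sum_(e' | (e' != e) && (src e' == src e)) 2 * label_weight e)).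
  by apply: ler_sum => e' /andP[e'e _]; exact: prob_alloc_pair.
rewrite sumr_const -[leLHS]mulr_natr natrM [leLHS]mulrAC ler_wpM2r ?divr_ge0 //.
rewrite ler_wpM2l // ler_nat (leq_trans _ (srcD1 (src e))) // subset_leq_card //.
by apply/fintype.subsetP => e'; rewrite unfold_in inE => /andP[].
Qed.
End Expectation.
End Allocations.

(** * Degrees after erasure *)

Section Erasure.
Variables (N m : nat) (src tgt : {ffun 'I_m -> 'I_N}).
Local Notation B := (bad_edges src tgt).

Definition erased_graph : digraph N :=
  erase [seq (src e, tgt e) | e <- enum 'I_m].
Local Notation g := erased_graph.

Definition src_deg (v : 'I_N) := #|[set e | src e == v]|.
Definition tgt_deg (v : 'I_N) := #|[set e | tgt e == v]|.

Lemma mem_erased_graph x :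
  (x \in g) = (x.1 != x.2) && [exists e, (src e, tgt e) == x].
Proof.
rewrite inE andbC; congr (_ && _).
apply/mapP/existsP => [[e _ ->]|[e /eqP <-]]; first by exists e.
by exists e; rewrite ?mem_enum.
Qed.

Lemma good_edge_inj e e' : e \notin B -> src e' = src e -> tgt e' = tgt e -> e' = e.
Proof.
rewrite inE negb_or => /andP[_ /existsPn/(_ e')] + se te.
by rewrite se te !eqxx !andbT negbK => /eqP.
Qed.

Lemma good_edge_mem e : e \notin B -> (src e, tgt e) \in g.
Proof.
rewrite inE negb_or => /andP[loop _]; rewrite mem_erased_graph loop.
by apply/existsP; exists e.
Qed.

(** No bad edge leaves [v], so the edges leaving it are not loops and have distinct targets: each of
    them yields its own edge of the erased graph. *)
Lemma outdeg_good v : v \notin src @: B -> outdeg g v = src_deg v.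
Proof.
move=> vB.
have good e : src e = v -> e \notin B by move=> sv; apply: contra vB; rewrite -sv; exact: imset_f.
rewrite /outdeg /src_deg -(card_in_imset (f := tgt)); last first.
  move=> e e'; rewrite !inE => /eqP se /eqP se' te.
  by apply: good_edge_inj => //; [exact: good | rewrite se se'].
apply: eq_card => w; rewrite inE; apply/idP/imsetP => [|[e]].
  rewrite mem_erased_graph => /andP[_ /existsP[e /eqP[se te]]].
  by exists e; rewrite ?inE ?se.
by rewrite inE => /eqP se ->; rewrite -se good_edge_mem ?good.
Qed.

Lemma indeg_good v : v \notin tgt @: B -> indeg g v = tgt_deg v.
Proof.
move=> vB.
have good e : tgt e = v -> e \notin B by move=> sv; apply: contra vB; rewrite -sv; exact: imset_f.
rewrite /indeg /tgt_deg -(card_in_imset (f := src)); last first.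
  move=> e e'; rewrite !inE => /eqP te /eqP te' se.
  by apply: good_edge_inj => //; [exact: good | rewrite te te'].
apply: eq_card => w; rewrite inE; apply/idP/imsetP => [|[e]].
  rewrite mem_erased_graph => /andP[_ /existsP[e /eqP[se te]]].
  by exists e; rewrite ?inE ?te.
by rewrite inE => /eqP te ->; rewrite -te good_edge_mem ?good.
Qed.

Section NodeCount.
Variables (j k : nat).
Let S := [set v | (tgt_deg v == j) && (src_deg v == k)].
Let touched := src @: B :|: tgt @: B.

Let touched_le : (#|touched| <= 2 * #|B|)%N.
Proof.
rewrite (leq_trans (leq_card_setU _ _)) // mul2n -addnn.
by rewrite leq_add // leq_imset_card.
Qed.

Let node_type_good v : v \notin touched ->
  (node_type g v == (j, k)) = (v \in S).
Proof.
rewrite inE negb_or => /andP[vs vt].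
by rewrite inE /node_type outdeg_good // indeg_good.
Qed.

Lemma num_nodes_le : (num_nodes g j k <= #|S| + 2 * #|B|)%N.
Proof.
apply: leq_trans (leq_add (leqnn _) touched_le).
apply: leq_trans (leq_card_setU _ _); apply: subset_leq_card.
apply/fintype.subsetP => v; rewrite inE => ty; rewrite finset.in_setU.
by have [|/node_type_good <-] := boolP (v \in touched); rewrite ?orbT ?ty.
Qed.

Lemma num_nodes_ge : (#|S| <= num_nodes g j k + 2 * #|B|)%N.
Proof.
apply: leq_trans (leq_add (leqnn _) touched_le).
apply: leq_trans (leq_card_setU _ _); apply: subset_leq_card.
apply/fintype.subsetP => v vS; rewrite finset.in_setU.
have [|/node_type_good] := boolP (v \in touched); first by rewrite orbT.
by rewrite orbF inE => ->.
Qed.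
End NodeCount.

Section EdgeCount.
Variables (D1 D2 : nat).
Hypothesis src_degD : forall v, (src_deg v <= D1)%N.
Hypothesis tgt_degD : forall v, (tgt_deg v <= D2)%N.

(** The type of an edge depends only on the out-degree of its source and the in-degree of its
    target. These are the edges for which neither is affected by the erasure; in particular they are
    good themselves. *)
Let G := [set e | (src e \notin src @: B) && (tgt e \notin tgt @: B)].
Let ends e := (src e, tgt e).

Let card_fibres (f : {ffun 'I_m -> 'I_N}) D :
  (forall v, #|[set e | f e == v]| <= D)%N ->
  (#|[set e | f e \in f @: B]| <= D * #|B|)%N.
Proof.
move=> fD; apply: leq_trans (leq_mul (leqnn _) (leq_imset_card f B)).
rewrite mulnC -sum_nat_const -sum1_card.
rewrite (partition_big f (mem (f @: B))) /=; last by move=> e; rewrite inE.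
apply: leq_sum => v _; apply: leq_trans (fD v).
rewrite sum1_card subset_leq_card //; apply/fintype.subsetP => e.
by rewrite unfold_in inE => /andP[].
Qed.

(** A bad edge spoils only the at most [D1] edges sharing its source and the at most [D2] edges
    sharing its target. *)
Let card_badC : (#|~: G| <= (D1 + D2) * #|B|)%N.
Proof.
rewrite mulnDl; apply: leq_trans (leq_add (card_fibres src_degD) (card_fibres tgt_degD)).
apply: leq_trans (leq_card_setU _ _); apply: subset_leq_card.
by apply/fintype.subsetP => e; rewrite !inE negb_and !negbK.
Qed.

Let G_good e : e \in G -> e \notin B.
Proof. by rewrite inE => /andP[+ _]; apply: contra => eB; exact: imset_f. Qed.

Let ends_inj : {in G &, injective ends}.
Proof. by move=> e e' _ e'G [se te]; apply: good_edge_inj => //; exact: G_good. Qed.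

Let edge_type_good e : e \in G -> edge_type g (ends e) = (src_deg (src e), tgt_deg (tgt e)).
Proof. by rewrite inE => /andP[es et]; rewrite /edge_type outdeg_good // indeg_good. Qed.

Let mem_ends x : x \in g -> exists e, x = ends e.
Proof. by rewrite mem_erased_graph => /andP[_ /existsP[e /eqP <-]]; exists e. Qed.

Lemma card_erased_le : (#|g| <= m)%N.
Proof.
rewrite -[leqRHS]card_ord -cardsT; apply: leq_trans (leq_imset_card ends _).
apply: subset_leq_card; apply/fintype.subsetP => x /mem_ends[e ->]; exact: imset_f.
Qed.

Lemma card_erased_ge : (m <= #|g| + (D1 + D2) * #|B|)%N.
Proof.
rewrite -[leqLHS]card_ord -cardsT -(finset.setUCr G).
apply: leq_trans (leq_card_setU _ _) _; apply: leq_add => //.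
rewrite -(card_in_imset ends_inj); apply: subset_leq_card.
apply/fintype.subsetP => x /imsetP[e eG ->]; exact/good_edge_mem/G_good.
Qed.

Variables (k j : nat).
Let T := [set e | (src_deg (src e) == k) && (tgt_deg (tgt e) == j)].

Lemma num_edges_le : (num_edges g k j <= #|T| + (D1 + D2) * #|B|)%N.
Proof.
apply: leq_trans (leq_add (leqnn _) card_badC).
apply: leq_trans (leq_card_setU _ _); apply: leq_trans (leq_imset_card ends _).
apply: subset_leq_card; apply/fintype.subsetP => x.
rewrite inE => /andP[/mem_ends[e ->] ty]; apply: imset_f; rewrite finset.in_setU.
have [eG|] := boolP (e \in G); last by rewrite finset.in_setC orbC => ->.
by rewrite inE -xpair_eqE -edge_type_good ?ty.
Qed.

Lemma num_edges_ge : (#|T| <= num_edges g k j + (D1 + D2) * #|B|)%N.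
Proof.
rewrite -(cardsID G T); apply: leq_add.
  rewrite -(card_in_imset (f := ends)); last first.
    by move=> e e' /setIP[_ eG] /setIP[_ e'G]; exact: ends_inj.
  apply: subset_leq_card; apply/fintype.subsetP => x /imsetP[e /setIP[eT eG] ->].
  rewrite inE good_edge_mem ?G_good //= edge_type_good // xpair_eqE.
  by move: eT; rewrite inE.
apply: leq_trans card_badC; apply: subset_leq_card; apply/fintype.subsetP => e.
by rewrite finset.in_setD finset.in_setC => /andP[].
Qed.
End EdgeCount.
End Erasure.

(** * Existence of allocations *)

Section Existence.
Variables (N m : nat) (deg lab : seq nat).
Hypotheses (N_gt0 : (0 < N)%N) (size_deg : size deg = N) (size_lab : size lab = m).
Hypothesis matching : forall d, count_mem d lab = (d * count_mem d deg)%N.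

Let dg (v : 'I_N) := nth 0%N deg v.
Let stubs : seq 'I_N := flatten [seq nseq (dg v) v | v <- enum 'I_N].

Let count_stubs v : count_mem v stubs = dg v.
Proof.
rewrite count_flatten -map_comp sumnE big_map big_enum /= (bigD1 v) //= count_nseq /= eqxx.
rewrite mul1n big1 ?addn0 // => w wv; by rewrite /= count_nseq /= (negPf wv).
Qed.

Let deg_map : deg = map dg (enum 'I_N).
Proof. by rewrite (map_comp (nth 0%N deg) val) val_enum_ord -size_deg -/(mkseq _ _) mkseq_nth. Qed.

Let perm_stubs : perm_eq lab (map dg stubs).
Proof.
apply/allP => d _ /=; apply/eqP.
rewrite matching [in LHS]deg_map [in LHS]count_map count_map count_flatten -map_comp sumnE big_map.
rewrite -sum1_count big_distrr /= [LHS]big_mkcond /=; apply: eq_bigr => v _.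
by rewrite count_nseq /=; case: eqVneq => [->|_]; rewrite ?muln1 ?mul1n ?mul0n.
Qed.

(** The list [stubs] repeats each node as often as its degree. By [matching] the degrees along it
    form a permutation of [lab], and reordering it accordingly gives an allocation. *)
Lemma allocations_nonempty : allocations N m deg lab != finset.set0.
Proof.
pose v0 := Ordinal N_gt0.
case/(perm_iotaP 0%N): perm_stubs => Is perm_Is lab_Is.
pose stubs' := [seq nth v0 stubs i | i <- Is].
rewrite size_map in perm_Is.
have perm' : perm_eq stubs' stubs.
  by rewrite -[X in perm_eq _ X](mkseq_nth v0) /mkseq perm_map.
have lab' : lab = map dg stubs'.
  rewrite lab_Is -map_comp; apply/eq_in_map => i; rewrite (perm_mem perm_Is) mem_iota /= => iI.
  by rewrite (nth_map v0).
have size' : size stubs' = m by rewrite -size_lab lab' size_map.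
have stubs'E : stubs' = map (fun e : 'I_m => nth v0 stubs' e) (enum 'I_m).
  by rewrite (map_comp (nth v0 stubs') val) val_enum_ord -size' -/(mkseq _ _) mkseq_nth.
apply/set0Pn; exists [ffun e : 'I_m => nth v0 stubs' e]; rewrite inE.
apply/andP; split; apply/forallP; last first.
  move=> v; rewrite -[nth _ _ _]count_stubs -(seq.permP perm') [in X in _ == X]stubs'E
    count_map -sum1_count big_enum_cond /= -sum1_card.
  by apply/eqP; apply: eq_bigl => e; rewrite inE ffunE.
move=> e; by rewrite ffunE lab' (nth_map v0) // size'.
Qed.
End Existence.

(** * Degree and label counts after completion *)

Section AssignFirst.

Lemma size_assign_first n k s : size (assign_first n k s) = size s.
Proof. by elim: s n => [|[|d] s IH] [|n] //=; rewrite IH. Qed.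

Lemma all_assign_first D n k s : (k <= D)%N ->
  all (leq^~ D) s -> all (leq^~ D) (assign_first n k s).
Proof.
move=> kD; elim: s n => [|[|d] s IH] [|n] //=.
- by move=> /IH; apply.
- by move=> /IH ->; rewrite kD.
- by move=> /andP[-> /IH ->].
- by move=> /andP[-> /IH ->].
Qed.

(** Stated additively, with the used zeros on the left, to stay clear of truncated subtraction. *)
Lemma count_assign_first (n k : nat) (s : seq nat) (d : nat) : (0 < k)%N -> (n <= count_mem 0%N
  s)%N ->
  (count_mem d (assign_first n k s) + (d == 0%N) * n
    = count_mem d s + (d == k) * n)%N.
Proof.
move=> k0; elim: s n => [|[|x] s IH] [|n] //= ns; rewrite ?muln0 ?addn0 //.
- by have := IH 0%N (leq0n _); rewrite !muln0 !addn0 => ->.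
- have := IH n ns. rewrite !mulnS; rewrite (eq_sym 0%N) (eq_sym k).
  move=> E.
  by rewrite addnACA E [RHS]addnACA; congr (_ + _)%N; rewrite addnC.
- by have := IH 0%N (leq0n _); rewrite !muln0 !addn0 => ->.
have E := IH n.+1 ns. by rewrite -!addnA E.
Qed.

Variable M : nat -> nat.
Let assign_all := foldl (fun s k => assign_first (M k) k s).

Lemma size_assign_all s ks : size (assign_all s ks) = size s.
Proof. by elim: ks s => //= k ks IH s; rewrite IH size_assign_first. Qed.

Lemma all_assign_all D s ks : all (leq^~ D) ks ->
  all (leq^~ D) s -> all (leq^~ D) (assign_all s ks).
Proof.
elim: ks s => //= k ks IH s /andP[kD ksD] sD.
by apply: IH => //; exact: all_assign_first.
Qed.

(** The zeros must last through all passes, whence the bound on the sum of [M]; positive entries are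
    never overwritten by later passes. *)
Lemma count_assign_all (s ks : seq nat) (d : nat) : all (leq 1) ks -> uniq ks ->
  (\sum_(k <- ks) M k <= count_mem 0%N s)%N -> (0 < d)%N ->
  count_mem d (assign_all s ks) = (count_mem d s + (d \in ks) * M d)%N.
Proof.
move=> + + + d0; elim: ks s => [|k ks IH] s /=; first by rewrite addn0.
move=> /andP[k0 ks0] /andP[kks uks]; rewrite big_cons => Ms.
have Mk : (M k <= count_mem 0%N s)%N by apply: leq_trans Ms; rewrite leq_addr.
have c0 := count_assign_first 0%N k0 Mk.
have cd := count_assign_first d k0 Mk.
rewrite IH //; last by move: c0; rewrite eqxx (ltn_eqF k0) /=; lia.
move: cd; rewrite (gtn_eqF d0) addn0 => ->; rewrite inE.
case: eqVneq => [->|_] /=; last by rewrite addn0.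
by rewrite (negPf kks) addn0.
Qed.
End AssignFirst.

Section Demand.
Context {R : realType}.

Lemma natceilE (x : R) : 0 <= x -> (natceil x)%:R = (Num.ceil x)%:~R :> R.
Proof.
move=> x0; rewrite /natceil natr_absz ger0_norm // ceil_ge0.
by rewrite (lt_le_trans _ x0) ?ltrN10.
Qed.

Lemma natceil_ge (x : R) : 0 <= x -> x <= (natceil x)%:R.
Proof. by move=> x0; rewrite natceilE // ceil_ge. Qed.

Lemma natceil_lt (x : R) : 0 <= x -> (natceil x)%:R < x + 1.
Proof. by move=> x0; rewrite natceilE // -ltrBlDr -[1]/(1%:~R) -intrB ceilB1_lt. Qed.

Lemma demand_ge (ed : seq nat) k : (count_mem k ed)%:R / k%:R <= (@demand R ed k)%:R :> R.
Proof. by rewrite mulrC natceil_ge // mulr_ge0 ?invr_ge0. Qed.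

Lemma demand_lt (ed : seq nat) k : (@demand R ed k)%:R < (count_mem k ed)%:R / k%:R + 1 :> R.
Proof. by rewrite mulrC natceil_lt // mulr_ge0 ?invr_ge0. Qed.

Lemma count_le_demand (ed : seq nat) k : (0 < k)%N ->
  (count_mem k ed <= k * @demand R ed k)%N.
Proof.
move=> k0; have := demand_ge ed k; rewrite ler_pdivrMr ?ltr0n //.
by rewrite -natrM ler_nat mulnC.
Qed.

Lemma deficit_lt (ed : seq nat) k : (0 < k)%N -> (@deficit R ed k < k)%N.
Proof.
move=> k0; rewrite /deficit ltn_subLR ?count_le_demand // -(ltr_nat R) natrM natrD.
rewrite -ltr_pdivlMl ?ltr0n // mulrDr mulVf ?pnatr_eq0 -?lt0n //.
by rewrite mulrC; exact: demand_lt.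
Qed.

Lemma deficitK (ed : seq nat) k : (0 < k)%N ->
  (count_mem k ed + @deficit R ed k = k * @demand R ed k)%N.
Proof. by move=> k0; rewrite subnKC ?count_le_demand. Qed.

(** Each deficit is smaller than its label. This is why [maxn (J ^ 2) (K ^ 2)] nodes are reserved in
    addition to the slack. *)
Lemma total_deficit_le (D : nat) (ed : seq nat) : (@total_deficit R D ed <= D ^ 2)%N.
Proof.
rewrite /total_deficit big_add1 big_mkord.
apply: (@leq_trans (\sum_(i < D) D)); last by rewrite sum_nat_const card_ord.
apply: leq_sum => i _; rewrite (leq_trans (ltnW (deficit_lt _ _))) //.
Qed.
End Demand.

Section Completion.
Context {R : realType}.
Variables (J K : nat) (delta : R) (N : nat).
Hypothesis adm : admissible J K delta N.

Lemma size1_gt0 : (0 < size1 J K delta N)%N.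
Proof. by case: adm => N' [N'0 NE]; rewrite /size1 {1}NE -addnA addnK. Qed.

Lemma reserveE : (N = size1 J K delta N + (2 * slack delta N + maxn (J ^ 2) (K ^ 2)))%N.
Proof. by case: adm => N' [N'0 NE]; rewrite subnK // {2}NE -addnA leq_addl. Qed.

Lemma reserve_size : (N - size1 J K delta N = 2 * slack delta N + maxn (J ^ 2) (K ^ 2))%N.
Proof. by have := reserveE; move: (size1 _ _ _ _) => s {1}->; rewrite addKn. Qed.
End Completion.

Section CompleteDegrees.
Context {R : realType}.
Variables (J K : nat) (delta : R) (N D : nat) (p : nat -> R) (nd ed : seq nat) (r : nat).
Hypothesis adm : admissible J K delta N.
Hypothesis D_gt0 : (0 < D)%N.
Hypothesis p_ge0 : forall k, (1 <= k <= D)%N -> 0 <= p k.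
Hypothesis p_le1 : \sum_(k <- iota 1 D) p k <= 1.
Hypothesis bal : balanced J K delta N D p nd ed.
Hypothesis r_le : (r <= maxn (J ^ 2) (K ^ 2))%N.
Local Notation degs := (complete_degrees J K delta N D nd ed r).
Local Notation h := (N%:R `^ delta).

Let slack_ge : h <= (slack delta N)%:R.
Proof. by apply: natceil_ge; exact: powR_ge0. Qed.

Let range k : k \in iota 1 D -> (1 <= k <= D)%N.
Proof. by rewrite mem_iota add1n ltnS. Qed.

Let balP k : (1 <= k <= D)%N ->
  `|(count_mem k nd)%:R - p k * (size1 J K delta N)%:R| <= p k * h / 2
  /\ `|(@demand R ed k)%:R - p k * (size2 J K delta N)%:R| <= p k * h / 2.
Proof.
move=> kD; have := allP bal k; rewrite mem_iota add1n ltnS kD => /(_ isT) /andP[].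
by [].
Qed.

(** The centre of the demand exceeds that of the node count by [p k * slack], at least [p k * h],
    and two deviations of [p k * h / 2] cannot overcome this. Hence the subtraction in
    [complete_degrees] is not truncated. *)
Lemma count_le_demand_balanced k : (1 <= k <= D)%N -> (count_mem k nd <= @demand R ed k)%N.
Proof.
move=> kD; have [] := balP kD; rewrite !ler_distl => /andP[_ h1] /andP[h2 _].
rewrite -(ler_nat R) (le_trans h1) // (le_trans _ h2) // /size2 natrD.
have := ler_wpM2l (p_ge0 kD) slack_ge; lra.
Qed.

(** The gap is at most [p k * (slack + h)]. Summed over [k] it gives the [2 * slack] of the reserve,
    the [p k] adding up to at most 1. *)
Lemma demand_gap k : (1 <= k <= D)%N ->
  (@demand R ed k - count_mem k nd)%:R <= p k * (2 * slack delta N)%:R.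
Proof.
move=> kD; have [] := balP kD; rewrite !ler_distl => /andP[h1 _] /andP[_ h2].
rewrite natrB ?count_le_demand_balanced //; move: h2; rewrite /size2 natrD natrM.
have := ler_wpM2l (p_ge0 kD) slack_ge; lra.
Qed.

Lemma size_complete_degrees : size degs = (size nd + (N - size1 J K delta N))%N.
Proof. by rewrite size_cat size_assign_all size_nseq. Qed.

Lemma all_complete_degrees : all (leq^~ D) nd -> all (leq^~ D) degs.
Proof.
move=> ndD; rewrite all_cat ndD /=; apply: all_assign_all; last by rewrite all_nseq orbT.
by apply/allP => k /range/andP[].
Qed.

Lemma nth_complete_degrees i : (i < size nd)%N -> nth 0%N degs i = nth 0%N nd i.
Proof. by move=> i_lt; rewrite nth_cat i_lt. Qed.

Lemma count_complete_degrees d : (1 <= d <= D)%N ->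
  count_mem d degs = (@demand R ed d + (d == 1) * r)%N.
Proof.
move=> dD; have [d0 _] := andP dD.
rewrite count_cat count_assign_all ?iota_uniq //.
- rewrite count_nseq /= (ltn_eqF d0) mul0n add0n mem_iota add1n ltnS dD mul1n.
  rewrite addnA subnKC ?count_le_demand_balanced //.
  by case: eqP; rewrite ?mul1n.
- by apply/allP => k /range/andP[].
(* The reserve suffices: the gaps fit into [2 * slack], the [r] extra nodes of degree 1 into the
   remaining term. *)
rewrite count_nseq /= mul1n (reserve_size adm) big_split /= leq_add //.
  rewrite -(ler_nat R) natr_sum.
  apply: (@le_trans _ _ (\sum_(k <- iota 1 D) p k * (2 * slack delta N)%:R)).
    by rewrite big_seq [leRHS]big_seq; apply: ler_sum => k /range kD; exact: demand_gap.
  by rewrite -mulr_suml -[leRHS]mul1r ler_wpM2r.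
rewrite (leq_trans _ r_le) // -big_mkcond /= -{2}(mul1n r).
rewrite big_const_seq iter_addn_0 mulnC leq_mul2r orbC.
by rewrite count_uniq_mem ?iota_uniq // leq_b1.
Qed.
End CompleteDegrees.

Section CompleteEdges.
Context {R : realType}.
Variables (J K : nat) (et : seq (nat * nat)).
Hypothesis etK : all (fun x => 1 <= x.1 <= K)%N et.
Hypothesis etJ : all (fun x => 1 <= x.2 <= J)%N et.
Local Notation ets := (@complete_edges R J K et).
Local Notation added1 := [seq nseq (@deficit R (unzip1 et) k) (k, 1%N) | k <- iota 1 K].
Local Notation added2 := [seq nseq (@deficit R (unzip2 et) j) (1%N, j) | j <- iota 1 J].

Let count_flatten_nseq (T : eqType) (f : nat -> nat) (x : nat -> T) (P : pred T) s :
  count P (flatten [seq nseq (f k) (x k) | k <- s]) = (\sum_(k <- s) P (x k) * f k)%N.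
Proof.
by rewrite count_flatten -map_comp sumnE big_map; apply: eq_bigr => k _ /=; rewrite count_nseq.
Qed.

Let sum_iota_pick (D d : nat) (f : nat -> nat) :
  (\sum_(k <- iota 1 D) (k == d) * f k = (1 <= d <= D) * f d)%N.
Proof.
have -> : (1 <= d <= D)%N = (d \in iota 1 D) by rewrite mem_iota add1n ltnS.
have [dD|dD] := boolP (d \in iota 1 D).
  rewrite (bigD1_seq d) ?iota_uniq //= eqxx big1_seq ?addn0 // => k /andP[/negPf -> _].
  by [].
rewrite big1_seq // => k /andP[_ kD]; case: eqP => // kd.
by rewrite -kd kD in dD.
Qed.

Let total_deficitE D ed : @total_deficit R D ed = (\sum_(k <- iota 1 D) @deficit R ed k)%N.
Proof. by rewrite /total_deficit /index_iota subn1. Qed.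

Lemma count_unzip1_complete_edges d :
  count_mem d (unzip1 ets) = (count_mem d (unzip1 et)
    + ((1 <= d <= K) * @deficit R (unzip1 et) d
       + (d == 1) * @total_deficit R J (unzip2 et)))%N.
Proof.
rewrite count_map !count_cat !count_flatten_nseq /= sum_iota_pick count_map.
by rewrite -big_distrr /= total_deficitE eq_sym.
Qed.

Lemma count_unzip2_complete_edges d :
  count_mem d (unzip2 ets) = (count_mem d (unzip2 et)
    + ((1 <= d <= J) * @deficit R (unzip2 et) d
       + (d == 1) * @total_deficit R K (unzip1 et)))%N.
Proof.
rewrite count_map !count_cat !count_flatten_nseq /= sum_iota_pick count_map.
by rewrite -big_distrr /= total_deficitE eq_sym [in LHS](addnC (_ * _)%N).
Qed.

Lemma size_complete_edges : size ets = (size et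
    + (@total_deficit R K (unzip1 et) + @total_deficit R J (unzip2 et)))%N.
Proof.
by rewrite -!(count_predT (_ : seq (nat * nat))) !count_cat !count_flatten_nseq !total_deficitE;
  do 2!congr (_ + _)%N; apply: eq_bigr => k _; rewrite mul1n.
Qed.
End CompleteEdges.

Section Matching.
Context {R : realType}.

(** For [d] in range both sides equal [d * demand ed d + (d == 1) * r], since the deficit rounds the
    number of edges up to a multiple of [d]; out of range both vanish. *)
Lemma matching_counts (D : nat) (deg lab ed : seq nat) (r : nat) : (0 < D)%N ->
  (forall d, 1 <= d <= D -> count_mem d deg = @demand R ed d + (d == 1) * r)%N ->
  all (leq^~ D) deg ->
  (forall d, count_mem d lab
     = count_mem d ed + ((1 <= d <= D) * @deficit R ed d + (d == 1) * r))%N ->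
  all (fun d => 1 <= d <= D)%N ed ->
  forall d, count_mem d lab = (d * count_mem d deg)%N.
Proof.
move=> D0 countD degD countL edD d; rewrite countL.
have [dD|dD] := boolP (1 <= d <= D)%N.
  have [d0 _] := andP dD.
  rewrite countD // mul1n addnA deficitK // mulnDr; congr (_ + _)%N.
  by case: eqP => [->|_]; rewrite ?mul1n ?muln0.
have -> : count_mem d ed = 0%N.
  by apply/count_memPn; apply: contra dD => /(allP edD).
have [->|d0] := posnP d; first by rewrite !mul0n.
have -> : count_mem d deg = 0%N.
  by apply/count_memPn; apply: contra dD => /(allP degD) ->; rewrite d0.
rewrite muln0; case: eqP dD => // ->; by rewrite D0.
Qed.

Lemma matching_label_le (D : nat) (deg lab : seq nat) : all (leq^~ D) deg ->
  (forall d, count_mem d lab = d * count_mem d deg)%N -> all (leq^~ D) lab.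
Proof.
move=> degD matching; apply/allP => d; rewrite -has_pred1 has_count matching muln_gt0.
by rewrite -has_count has_pred1 => /andP[_ /(allP degD)].
Qed.
End Matching.

Lemma nth_all_leq (D : nat) (s : seq nat) i : all (leq^~ D) s -> (nth 0%N s i <= D)%N.
Proof.
move=> sD; have [i_lt|i_ge] := ltnP i (size s); last by rewrite nth_default.
exact: all_nthP 0%N sD i i_lt.
Qed.

Lemma iota1E n : iota 1 n = index_iota 1 n.+1.
Proof. by rewrite /index_iota subn1. Qed.

Lemma card_ord_count (n : nat) (p : pred nat) : #|[set i : 'I_n | p i]| = count p (iota 0 n).
Proof.
rewrite -val_enum_ord count_map -sum1_card -sum1_count big_enum_cond /=.
by apply: eq_bigl => i; rewrite inE.
Qed.

Lemma count_nth (T : Type) (x0 : T) (p : pred T) (s : seq T) :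
  count (fun i => p (nth x0 s i)) (iota 0 (size s)) = count p s.
Proof. by rewrite -[in RHS](mkseq_nth x0 s) count_map. Qed.

(** * Type counts of a graph built from balanced types *)

Section MatchedGraph.
Context {R : realType}.
Variables (J K : nat) (P : nat -> nat -> R) (delta : R) (N : nat) (nt et : seq (nat * nat)).
Hypotheses (J_gt0 : (0 < J)%N) (K_gt0 : (0 < K)%N).
Hypothesis distP : is_dist (@node_pmf R J K P).
Hypothesis adm : admissible J K delta N.
Hypothesis size_nt : size nt = size1 J K delta N.
Hypothesis ntJK : all (fun x => (x.1 <= J) && (x.2 <= K))%N nt.
Hypothesis etKJ : all (fun x => (1 <= x.1 <= K) && (1 <= x.2 <= J))%N et.
Hypothesis bal_out : balanced J K delta N K (p_out J P) (unzip2 nt) (unzip1 et).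
Hypothesis bal_in : balanced J K delta N J (p_in K P) (unzip1 nt) (unzip2 et).

Let outs := complete_degrees J K delta N K (unzip2 nt) (unzip1 et)
              (@total_deficit R J (unzip2 et)).
Let ins := complete_degrees J K delta N J (unzip1 nt) (unzip2 et)
              (@total_deficit R K (unzip1 et)).
Let ets := @complete_edges R J K et.

Let P_ge0 j k : (j <= J)%N -> (k <= K)%N -> 0 <= P j k.
Proof. by move=> jJ kK; have [+ _] := distP;
  move/(_ (Ordinal (jJ : j < J.+1)%N, Ordinal (kK : k < K.+1)%N)). Qed.

Lemma p_out_ge0 k : (k <= K)%N -> 0 <= p_out J P k.
Proof. by move=> kK; rewrite /p_out big_mkord; apply: sumr_ge0 => j _; rewrite P_ge0 // -ltnS. Qed.

Lemma p_in_ge0 j : (j <= J)%N -> 0 <= p_in K P j.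
Proof. by move=> jJ; rewrite /p_in big_mkord; apply: sumr_ge0 => k _; rewrite P_ge0 // -ltnS. Qed.

Let total : \sum_(j < J.+1) \sum_(k < K.+1) P j k = 1.
Proof. by have [_ <-] := distP; rewrite pair_bigA; apply: eq_bigr => -[]. Qed.

Lemma sum_p_out_le1 : \sum_(k <- iota 1 K) p_out J P k <= 1.
Proof.
rewrite -total [leRHS]exchange_big /= big_ord_recl /=.
rewrite iota1E big_add1 /= big_mkord.
have E k : p_out J P k = \sum_(j < J.+1) P j k by rewrite /p_out big_mkord.
rewrite [leLHS](eq_bigr _ (fun (k : 'I_K) _ => E k.+1)).
by rewrite lerDr sumr_ge0 // => j _; rewrite P_ge0 // -ltnS.
Qed.

Lemma sum_p_in_le1 : \sum_(j <- iota 1 J) p_in K P j <= 1.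
Proof.
rewrite -total big_ord_recl /=.
rewrite iota1E big_add1 /= big_mkord.
have E j : p_in K P j = \sum_(k < K.+1) P j k by rewrite /p_in big_mkord.
rewrite [leLHS](eq_bigr _ (fun (j : 'I_J) _ => E j.+1)).
by rewrite lerDr sumr_ge0 // => j _; rewrite P_ge0 // -ltnS.
Qed.

Let outsK : all (leq^~ K) outs.
Proof. by apply: all_complete_degrees; rewrite all_map; apply: sub_all ntJK => x /andP[]. Qed.

Let insJ : all (leq^~ J) ins.
Proof. by apply: all_complete_degrees; rewrite all_map; apply: sub_all ntJK => x /andP[]. Qed.

Let r_out_le : (@total_deficit R J (unzip2 et) <= maxn (J ^ 2) (K ^ 2))%N.
Proof. by rewrite (leq_trans (total_deficit_le _ _)) ?leq_maxl. Qed.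

Let r_in_le : (@total_deficit R K (unzip1 et) <= maxn (J ^ 2) (K ^ 2))%N.
Proof. by rewrite (leq_trans (total_deficit_le _ _)) ?leq_maxr. Qed.

Let matching_out d : count_mem d (unzip1 ets) = (d * count_mem d outs)%N.
Proof.
apply: (@matching_counts R K _ _ (unzip1 et)) => //.
- move=> d' d'K; apply: count_complete_degrees bal_out r_out_le _ d'K => //.
    by move=> k /andP[_ kK]; exact: p_out_ge0.
  exact: sum_p_out_le1.
- exact: count_unzip1_complete_edges.
- by rewrite all_map; apply: sub_all etKJ => x /andP[].
Qed.

Let matching_in d : count_mem d (unzip2 ets) = (d * count_mem d ins)%N.
Proof.
apply: (@matching_counts R J _ _ (unzip2 et)) => //.
- move=> d' d'J; apply: count_complete_degrees bal_in r_in_le _ d'J => //.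
    by move=> j /andP[_ jJ]; exact: p_in_ge0.
  exact: sum_p_in_le1.
- exact: count_unzip2_complete_edges.
- by rewrite all_map; apply: sub_all etKJ => x /andP[].
Qed.

Let N_gt0 : (0 < N)%N.
Proof. by rewrite (reserveE adm) ltn_addr // (size1_gt0 adm). Qed.

Let size_outs : size outs = N.
Proof. by rewrite size_complete_degrees size_map size_nt subnKC // {2}(reserveE adm) leq_addr. Qed.

Let size_ins : size ins = N.
Proof. by rewrite size_complete_degrees size_map size_nt subnKC // {2}(reserveE adm) leq_addr. Qed.

Local Notation Aout := (allocations N (size ets) outs (unzip1 ets)).
Local Notation Ain := (allocations N (size ets) ins (unzip2 ets)).

Lemma out_allocations_nonempty : Aout != finset.set0.
Proof. by apply: allocations_nonempty => //; rewrite size_map. Qed.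

Lemma in_allocations_nonempty : Ain != finset.set0.
Proof. by apply: allocations_nonempty => //; rewrite size_map. Qed.

Lemma is_dist_match_law : is_dist (@match_law R J K delta N nt et).
Proof.
apply: is_dist_bind; first exact/is_dist_uniform/out_allocations_nonempty.
move=> src _; apply: is_dist_bind; first exact/is_dist_uniform/in_allocations_nonempty.
by move=> tgt _; exact: is_dist_ret.
Qed.

(** The bound of [expect_bad_edges] with at most [K] edges leaving a node and target labels at most
    [J]. *)
Definition bad_bound : R := ((1 + 2 * K) * (J * J.+1))%:R.

Section Counts.
Variables (src tgt : {ffun 'I_(size ets) -> 'I_N}).
Hypotheses (srcA : src \in Aout) (tgtA : tgt \in Ain).
Local Notation B := (bad_edges src tgt).
Local Notation g := (erased_graph src tgt).

Let src_degE v : src_deg src v = nth 0%N outs v.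
Proof. exact: allocations_card srcA. Qed.

Let tgt_degE v : tgt_deg tgt v = nth 0%N ins v.
Proof. exact: allocations_card tgtA. Qed.

Let src_degK v : (src_deg src v <= K)%N.
Proof. by rewrite src_degE; exact: nth_all_leq. Qed.

Let tgt_degJ v : (tgt_deg tgt v <= J)%N.
Proof. by rewrite tgt_degE; exact: nth_all_leq. Qed.

(** Before erasure the first nodes keep the types drawn for them, so only reserve nodes can add to a
    count. *)
Let type_count j k : (count_mem (j, k) nt
  <= #|[set v | (tgt_deg tgt v == j) && (src_deg src v == k)]|
  <= count_mem (j, k) nt + (N - size1 J K delta N))%N.
Proof.
pose p i := (nth 0%N ins i == j) && (nth 0%N outs i == k).
have -> : #|[set v | (tgt_deg tgt v == j) && (src_deg src v == k)]| = #|[set v : 'I_N | p v]|.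
  by apply: eq_card => v; rewrite !inE src_degE tgt_degE.
have n1N : (size1 J K delta N <= N)%N by rewrite [leqRHS](reserveE adm) leq_addr.
rewrite card_ord_count -{1 2}(subnKC n1N) iotaD count_cat add0n.
have -> : count p (iota 0 (size1 J K delta N)) = count_mem (j, k) nt.
  rewrite -(count_nth (0, 0)%N) size_nt; apply: eq_in_count => i; rewrite mem_iota add0n => /= i_lt.
  rewrite /p !nth_complete_degrees ?size_map ?size_nt //.
  by rewrite !(nth_map (0, 0)%N) ?size_nt //; case: nth.
by rewrite leq_addr leq_add2l (leq_trans (count_size _ _)) // size_iota.
Qed.

Lemma num_nodes_dev j k :
  `|(num_nodes g j k)%:R - (count_mem (j, k) nt)%:R|
    <= (N - size1 J K delta N)%:R + 2 * #|B|%:R :> R.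
Proof.
have /andP[t1 t2] := type_count j k.
have := num_nodes_le src tgt j k; have := num_nodes_ge src tgt j k.
rewrite ler_distl -natrM -natrD lerBlDr -!natrD !ler_nat => h1 h2.
apply/andP; split.
  by apply: leq_trans t1 _; apply: leq_trans h1 _; rewrite leq_add2l leq_addl.
by apply: leq_trans h2 _; rewrite addnA leq_add2r.
Qed.

(** In an allocation the degrees at the ends of an edge are its labels, so before erasure only the
    added edges, at most [K ^ 2 + J ^ 2] in number, are missing from [et]. *)
Let label_count_edges k j : (count_mem (k, j) et
  <= #|[set e | (src_deg src (src e) == k) && (tgt_deg tgt (tgt e) == j)]|
  <= count_mem (k, j) et + (K ^ 2 + J ^ 2))%N.
Proof.
have -> : #|[set e | (src_deg src (src e) == k) && (tgt_deg tgt (tgt e) == j)]| = count_mem (k,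
  j) ets.
  rewrite -(count_nth (0, 0)%N) -card_ord_count; apply: eq_card => e;
    rewrite !inE src_degE tgt_degE.
  rewrite (allocations_deg _ srcA) (allocations_deg _ tgtA).
  by rewrite !(nth_map (0, 0)%N) //; case: nth.
rewrite count_cat leq_addr leq_add2l (leq_trans (count_size _ _)) //.
rewrite -(leq_add2l (size et)) -size_cat size_complete_edges leq_add2l.
by rewrite leq_add // total_deficit_le.
Qed.

Lemma num_edges_dev k j :
  `|(num_edges g k j)%:R - (count_mem (k, j) et)%:R|
    <= (K ^ 2 + J ^ 2)%:R + (K + J)%:R * #|B|%:R :> R.
Proof.
have /andP[t1 t2] := label_count_edges k j.
have := num_edges_le src_degK tgt_degJ k j; have := num_edges_ge src_degK tgt_degJ k j.
rewrite ler_distl -natrM -natrD lerBlDr -!natrD !ler_nat => h1 h2.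
apply/andP; split.
  by apply: leq_trans t1 _; apply: leq_trans h1 _; rewrite leq_add2l leq_addl.
by apply: leq_trans h2 _; rewrite addnA leq_add2r.
Qed.

Lemma card_erased_dev :
  `|#|g|%:R - (size et)%:R| <= (K ^ 2 + J ^ 2)%:R + (K + J)%:R * #|B|%:R :> R.
Proof.
have := card_erased_le src tgt; have := card_erased_ge src_degK tgt_degJ.
have : (size ets <= size et + (K ^ 2 + J ^ 2))%N.
  by rewrite size_complete_edges leq_add2l leq_add // total_deficit_le.
have : (size et <= size ets)%N by rewrite size_complete_edges leq_addr.
rewrite ler_distl -natrM -natrD lerBlDr -!natrD !ler_nat => h1 h2 h3 h4.
apply/andP; split.
  by apply: leq_trans h1 _; apply: leq_trans h3 _; rewrite leq_add2l leq_addl.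
by apply: leq_trans h4 _; apply: leq_trans h2 _; rewrite leq_add2l leq_addr.
Qed.
End Counts.

(** Markov's inequality given the sources, for an event that forces [t] bad edges. The bound is the
    same for all source allocations and so survives averaging over them. *)
Lemma prob_match_law (A : pred (digraph N)) (t : R) : 0 < t ->
  (forall src tgt, src \in Aout -> tgt \in Ain -> A (erased_graph src tgt) ->
     t <= #|bad_edges src tgt|%:R) ->
  prob (@match_law R J K delta N nt et) A <= bad_bound / t.
Proof.
move=> t0 A_bad; rewrite /match_law prob_bind.
rewrite -[leRHS](expect_const _ (is_dist_uniform out_allocations_nonempty)).
apply: ler_expect => [src|src]; first exact: uniform_ge0.
rewrite mulf_eq0 negb_or pnatr_eq0 eqb0 negbK => /andP[srcA _].
rewrite prob_bind ler_pdivlMr // mulr_suml.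
apply: le_trans (expect_bad_edges ins (lab := unzip2 ets) (D2 := J) (src := src) _ _); last 2 first.
- by move=> v; rewrite (allocations_card v srcA) nth_all_leq.
- by move=> e; rewrite nth_all_leq // (matching_label_le insJ matching_in).
apply: ler_sum => tgt _; rewrite prob_ret -mulrA.
have [->|] := eqVneq (uniform Ain tgt : R) 0; first by rewrite !mul0r.
rewrite mulf_eq0 negb_or pnatr_eq0 eqb0 negbK => /andP[tgtA _].
rewrite ler_wpM2l ?uniform_ge0 //.
case: (boolP (A _)) => [/A_bad|_]; rewrite ?mul1r ?mul0r //; exact.
Qed.
End MatchedGraph.

(** * Typical initial types *)

Section GoodTypes.
Context {R : realType}.

(** The tolerance is proportional to [mu x], so that summing over one component gives a tolerance
    proportional to the marginal, as in [balanced]. A type of mass 0 must not occur at all. *)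
Definition near_mean (T : finType) (n : nat) (mu : T -> R) (tau : R) (f : {ffun 'I_n -> T}) :
  bool :=
  [forall x, `|#|[set i | f i == x]|%:R - n%:R * mu x| <= tau * mu x].

Lemma prob_not_near_mean (T : finType) (n : nat) (mu : T -> R) (tau : R) :
  is_dist mu -> 0 < tau ->
  prob (iid n mu) (fun f => ~~ near_mean mu tau f)
    <= n%:R / tau ^+ 2 * \sum_x (mu x)^-1.
Proof.
move=> mu_dist tau0; have [iid0 _] := is_dist_iid n mu_dist.
rewrite mulr_sumr.
apply: (@le_trans _ _ (\sum_x prob (iid n mu)
  (fun f => tau * mu x < `|#|[set i | f i == x]|%:R - n%:R * mu x|))).
  rewrite [leLHS]prob_expect [leRHS](eq_bigr _ (fun x _ => prob_expect _ _)) /expect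
    exchange_big /=.
  apply: ler_sum => f _; rewrite -mulr_sumr ler_wpM2l //.
  rewrite negb_forall; case: existsP => [[x]|_]; last exact: sumr_ge0.
  by rewrite -ltNge => dev; rewrite (bigD1 x) //= dev lerDl sumr_ge0.
by apply: ler_sum => x _; exact: iid_deviation.
Qed.

Lemma card_fst (A B : finType) n (t : {ffun 'I_n -> A * B}) a :
  #|[set v | (t v).1 == a]| = (\sum_b #|[set v | t v == (a, b)]|)%N.
Proof.
rewrite -sum1_card (partition_big (fun v => (t v).2) xpredT) //=.
apply: eq_bigr => b _; rewrite -sum1_card; apply: eq_bigl => v.
by rewrite !inE [X in _ = (X == _)]surjective_pairing xpair_eqE.
Qed.

Lemma card_snd (A B : finType) n (t : {ffun 'I_n -> A * B}) b :
  #|[set v | (t v).2 == b]| = (\sum_a #|[set v | t v == (a, b)]|)%N.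
Proof.
rewrite -sum1_card (partition_big (fun v => (t v).1) xpredT) //=.
apply: eq_bigr => a _; rewrite -sum1_card; apply: eq_bigl => v.
by rewrite !inE [X in _ = (X == _)]surjective_pairing xpair_eqE andbC.
Qed.

Lemma near_mean_fst (A B : finType) n (mu : A * B -> R) tau (t : {ffun 'I_n -> A * B}) a :
  near_mean mu tau t ->
  `|#|[set v | (t v).1 == a]|%:R - n%:R * \sum_b mu (a, b)| <= tau * \sum_b mu (a, b).
Proof.
move=> /forallP near; rewrite card_fst natr_sum !mulr_sumr -sumrB.
by apply: le_trans (ler_norm_sum _ _ _) (ler_sum _ _) => b _; exact: near.
Qed.

Lemma near_mean_snd (A B : finType) n (mu : A * B -> R) tau (t : {ffun 'I_n -> A * B}) b :
  near_mean mu tau t ->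
  `|#|[set v | (t v).2 == b]|%:R - n%:R * \sum_a mu (a, b)| <= tau * \sum_a mu (a, b).
Proof.
move=> /forallP near; rewrite card_snd natr_sum !mulr_sumr -sumrB.
by apply: le_trans (ler_norm_sum _ _ _) (ler_sum _ _) => a _; exact: near.
Qed.

Lemma count_map_enum (T : eqType) (n : nat) (f : 'I_n -> T) x :
  count_mem x [seq f v | v <- enum 'I_n] = #|[set v | f v == x]|.
Proof.
rewrite count_map -sum1_count big_enum_cond /= -sum1_card.
by apply: eq_bigl => v; rewrite inE.
Qed.

(** Half of the tolerance, [p * h / 4], is the random fluctuation divided by [k]. The other half
    absorbs two roundings: at most 1 from the ceiling in [demand], and [p / z] from the one in the
    number [m0] of edges. For [p = 0] the label does not occur and the demand is exactly 0. *)
Lemma demand_dev (ed : seq nat) (k : nat) (p z h m0 s2 : R) :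
  (0 < k)%N -> 0 < z -> 0 <= p -> (0 < p -> 1 + p / z <= p * h / 4) ->
  z * s2 <= m0 <= z * s2 + 1 ->
  `|(count_mem k ed)%:R - m0 * (k%:R * p / z)| <= z / 4 * h * (k%:R * p / z) ->
  `|(@demand R ed k)%:R - p * s2| <= p * h / 2.
Proof.
move=> k0 z0 p0 large /andP[m0_ge m0_le] dev.
have kR : 0 < k%:R :> R by rewrite ltr0n.
have := demand_ge ed k (R := R); have := demand_lt ed k (R := R).
set x := _ / _ => dem_lt dem_ge.
have dev' : `|x - m0 * p / z| <= p * h / 4.
  rewrite -(ler_pM2r kR) -{1}(ger0_norm (ltW kR)) -normrM.
  rewrite (_ : (x - m0 * p / z) * k%:R = (count_mem k ed)%:R - m0 * (k%:R * p / z)).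
    apply: le_trans dev _; rewrite le_eqVlt; apply/orP; left; apply/eqP.
    by field; rewrite gt_eqF.
  by rewrite /x; field; rewrite !gt_eqF.
move: p0; rewrite le_eqVlt => /orP[/eqP p0|p0].
  move: dev'; rewrite -p0 !(mulr0, mul0r) subr0 normr_le0 => /eqP x0.
  rewrite x0 add0r -[1]/(1%:R) ltr_nat ltnS leqn0 in dem_lt.
  by rewrite (eqP dem_lt) subr0 normr0.
have hp := large p0.
have m0p_ge : p * s2 <= m0 * p / z by rewrite ler_pdivlMr // -mulrA mulrC ler_pM2r // mulrC.
have m0p_le : m0 * p / z <= p * s2 + p / z.
  rewrite ler_pdivrMr // mulrDl divfK ?gt_eqF //.
  by rewrite (_ : _ + p = (z * s2 + 1) * p) ?ler_wpM2r ?(ltW p0) //; ring.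
move: dev'; rewrite !ler_distl => /andP[d1 d2]; apply/andP; split; lra.
Qed.
End GoodTypes.

(** * Deviation of the type counts *)

Definition type_error {R : realType} (J K : nat) (P Q : nat -> nat -> R) (N : nat)
    (g : digraph N) : R :=
  \sum_(0 <= j < J.+1) \sum_(0 <= k < K.+1)
     `|(num_nodes g j k)%:R / N%:R - P j k|
   + \sum_(1 <= k < K.+1) \sum_(1 <= j < J.+1)
     `|(num_edges g k j)%:R / #|g|%:R - Q k j|.

Lemma node_types_bounded (J K n : nat) (t : {ffun 'I_n -> 'I_J.+1 * 'I_K.+1}) :
  all (fun x => (x.1 <= J) && (x.2 <= K))%N
    [seq ((t v).1 : nat, (t v).2 : nat) | v <- enum 'I_n].
Proof. by apply/allP => x /mapP[v _ ->]; apply/andP; split; rewrite -ltnS ltn_ord. Qed.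

Lemma edge_types_bounded (J K n : nat) (u : {ffun 'I_n -> 'I_K * 'I_J}) :
  all (fun x => (1 <= x.1 <= K) && (1 <= x.2 <= J))%N
    [seq ((u e).1.+1, (u e).2.+1) | e <- enum 'I_n].
Proof. by apply/allP => x /mapP[e _ ->] /=; rewrite !ltn_ord. Qed.

Section GraphError.
Context {R : realType}.
Variables (J K : nat) (P Q : nat -> nat -> R) (delta : R).
Hypotheses (J_gt0 : (1 <= J)%N) (K_gt0 : (1 <= K)%N).
Hypothesis distP : is_dist (@node_pmf R J K P).
Hypothesis distQ : is_dist (@edge_pmf R J K Q).
Hypothesis z_gt0 : 0 < mean_deg J K P.
Hypothesis C1 : forall k : nat, (1 <= k <= K)%N ->
  q_out J Q k = k%:R * p_out J P k / mean_deg J K P.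
Hypothesis C2 : forall j : nat, (1 <= j <= J)%N ->
  q_in K Q j = j%:R * p_in K P j / mean_deg J K P.
Local Notation z := (mean_deg J K P).

(* Makes [1 + p / z <= p * h / 4] whenever [p] is a positive marginal and [h]
   exceeds this value. *)
Definition marginal_threshold : R :=
  \sum_(k <- iota 1 K) (4 / p_out J P k + 4 / z)
  + \sum_(j <- iota 1 J) (4 / p_in K P j + 4 / z).

(** Error constants in units of [h]. For nodes: the reserve, at most [4 + maxn (J ^ 2) (K ^ 2)],
    counts twice, bad edges give 2 and the fluctuation 1/2, rounded up. For edges: the deviations of
    [num_edges] and of [#|g|] give one copy each of the first two terms, and the fluctuation at most
    [z]. The factor [2 / z] in [error_const] comes from [#|g|] being at least [z * N / 2]. *)
Definition node_const : R := 11 + 2 * (maxn (J ^ 2) (K ^ 2))%:R.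
Definition edge_const : R := 2 * (K ^ 2 + J ^ 2)%:R + 2 * (K + J)%:R + z.
Definition error_const : R :=
  (J.+1 * K.+1)%:R * node_const + (K * J)%:R * (2 * edge_const / z).

Variable N : nat.
Hypothesis adm : admissible J K delta N.
Local Notation h := (N%:R `^ delta).
Local Notation n1 := (size1 J K delta N).
Local Notation m0 := (num_init J K P delta N).
Hypothesis h_ge1 : 1 <= h.
Hypothesis h_large : marginal_threshold <= h.
Hypothesis h_small : (z * node_const + edge_const) * h <= z * N%:R / 2.

Let N_gt0 : (0 < N)%N.
Proof. by rewrite (reserveE adm) ltn_addr // (size1_gt0 adm). Qed.

Let threshold_terms_ge0 :
  (forall k, k \in iota 1 K -> 0 <= 4 / p_out J P k + 4 / z)
  /\ (forall j, j \in iota 1 J -> 0 <= 4 / p_in K P j + 4 / z).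
Proof.
split=> [k|j]; rewrite mem_iota add1n ltnS => /andP[_ le].
  by rewrite addr_ge0 // divr_ge0 // ?(ltW z_gt0) // (p_out_ge0 distP).
by rewrite addr_ge0 // divr_ge0 // ?(ltW z_gt0) // (p_in_ge0 distP).
Qed.

Let above_threshold (p : R) : 0 < p -> 4 / p + 4 / z <= h -> 1 + p / z <= p * h / 4.
Proof.
move=> p0 le_h.
have := ler_wpM2l (ltW p0) le_h; rewrite mulrDr.
rewrite (_ : p * (4 / p) = 4); last by field; rewrite gt_eqF.
by rewrite (_ : p * (4 / z) = 4 * (p / z)); [lra | field; rewrite gt_eqF].
Qed.

Let large_out k : (1 <= k <= K)%N -> 0 < p_out J P k -> 1 + p_out J P k / z <= p_out J P k * h / 4.
Proof.
move=> kK p0; apply: above_threshold => //; apply: le_trans h_large.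
have kI : k \in iota 1 K by rewrite mem_iota add1n ltnS.
have [out0 in0] := threshold_terms_ge0.
rewrite /marginal_threshold (bigD1_seq k) ?iota_uniq //= -addrA lerDl addr_ge0 //.
  by rewrite big_seq_cond sumr_ge0 // => i /andP[/out0].
by rewrite big_seq sumr_ge0.
Qed.

Let large_in j : (1 <= j <= J)%N -> 0 < p_in K P j -> 1 + p_in K P j / z <= p_in K P j * h / 4.
Proof.
move=> jJ p0; apply: above_threshold => //; apply: le_trans h_large.
have jI : j \in iota 1 J by rewrite mem_iota add1n ltnS.
have [out0 in0] := threshold_terms_ge0.
rewrite /marginal_threshold [leRHS]addrC (bigD1_seq j) ?iota_uniq //= -addrA lerDl addr_ge0 //.
  by rewrite big_seq_cond sumr_ge0 // => i /andP[/in0].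
by rewrite big_seq sumr_ge0.
Qed.

Let m0_bounds : z * (size2 J K delta N)%:R <= m0%:R <= z * (size2 J K delta N)%:R + 1.
Proof. by rewrite natceil_ge ?(ltW (natceil_lt _)) // mulr_ge0 // ltW. Qed.

Variables (t : {ffun 'I_n1 -> 'I_J.+1 * 'I_K.+1}) (u : {ffun 'I_m0 -> 'I_K * 'I_J}).
Hypothesis t_near : near_mean (@node_pmf R J K P) (h / 2) t.
Hypothesis u_near : near_mean (@edge_pmf R J K Q) (z / 4 * h) u.

Let nt := [seq ((t v).1 : nat, (t v).2 : nat) | v <- enum 'I_n1].
Let et := [seq ((u e).1.+1, (u e).2.+1) | e <- enum 'I_m0].

(** By (C1) about [m0 * k * p / z] edges carry label [k]. They need about [m0 * p / z] nodes, which
    is close to [p * size2], the centre required by [balanced]. *)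
Lemma near_balanced_out : balanced J K delta N K (p_out J P) (unzip2 nt) (unzip1 et).
Proof.
apply/allP => k; rewrite mem_iota add1n ltnS => kK.
have [k0 kleK] := andP kK.
have p_outE : p_out J P k = \sum_a @node_pmf R J K P (a, inord k).
  by rewrite /p_out big_mkord; apply: eq_bigr => a _; rewrite /node_pmf /= inordK.
apply/andP; split.
  rewrite /unzip2 -map_comp (count_map_enum (fun v => (t v).2 : nat)).
  have -> : #|[set v | (t v).2 == k :> nat]| = #|[set v | (t v).2 == inord k]|.
    by apply: eq_card => v; rewrite !inE -val_eqE /= inordK.
  by rewrite [p_out J P k * _]mulrC -mulrA [leRHS]mulrC p_outE near_mean_snd.
apply: (@demand_dev R _ _ _ z h m0%:R) => //.
- exact: (p_out_ge0 distP).
- exact: large_out.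
rewrite -C1 // /unzip1 -map_comp (count_map_enum (fun e => (u e).1.+1)).
have kK' : (k.-1 < K)%N by rewrite prednK.
have -> : #|[set e | (u e).1.+1 == k]| = #|[set e | (u e).1 == Ordinal kK']|.
  by apply: eq_card => e; rewrite !inE -val_eqE /= -[in LHS](prednK k0) eqSS.
have -> : q_out J Q k = \sum_b @edge_pmf R J K Q (Ordinal kK', b).
  by rewrite /q_out big_add1 big_mkord; apply: eq_bigr => b _; rewrite /edge_pmf /= prednK.
exact: near_mean_fst.
Qed.

Lemma near_balanced_in : balanced J K delta N J (p_in K P) (unzip1 nt) (unzip2 et).
Proof.
apply/allP => j; rewrite mem_iota add1n ltnS => jJ.
have [j0 jleJ] := andP jJ.
have p_inE : p_in K P j = \sum_b @node_pmf R J K P (inord j, b).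
  by rewrite /p_in big_mkord; apply: eq_bigr => b _; rewrite /node_pmf /= inordK.
apply/andP; split.
  rewrite /unzip1 -map_comp (count_map_enum (fun v => (t v).1 : nat)).
  have -> : #|[set v | (t v).1 == j :> nat]| = #|[set v | (t v).1 == inord j]|.
    by apply: eq_card => v; rewrite !inE -val_eqE /= inordK.
  by rewrite [p_in K P j * _]mulrC -mulrA [leRHS]mulrC p_inE near_mean_fst.
apply: (@demand_dev R _ _ _ z h m0%:R) => //.
- exact: (p_in_ge0 distP).
- exact: large_in.
rewrite -C2 // /unzip2 -map_comp (count_map_enum (fun e => (u e).2.+1)).
have jJ' : (j.-1 < J)%N by rewrite prednK.
have -> : #|[set e | (u e).2.+1 == j]| = #|[set e | (u e).2 == Ordinal jJ']|.
  by apply: eq_card => e; rewrite !inE -val_eqE /= -[in LHS](prednK j0) eqSS.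
have -> : q_in K Q j = \sum_a @edge_pmf R J K Q (a, Ordinal jJ').
  by rewrite /q_in big_add1 big_mkord; apply: eq_bigr => a _; rewrite /edge_pmf /= prednK.
exact: near_mean_snd.
Qed.

Let size_nt : size nt = n1.
Proof. by rewrite size_map size_enum_ord. Qed.

Let size_et : size et = m0.
Proof. by rewrite size_map size_enum_ord. Qed.

Let ntJK := node_types_bounded t.
Let etKJ := edge_types_bounded u.

Let outs := complete_degrees J K delta N K (unzip2 nt) (unzip1 et)
              (@total_deficit R J (unzip2 et)).
Let ins := complete_degrees J K delta N J (unzip1 nt) (unzip2 et)
              (@total_deficit R K (unzip1 et)).
Let ets := @complete_edges R J K et.

Let node_count_dev j k : (j <= J)%N -> (k <= K)%N ->
  `|(count_mem (j, k) nt)%:R - n1%:R * P j k| <= h / 2 * P j k.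
Proof.
move=> jJ kK.
rewrite (count_map_enum (fun v => ((t v).1 : nat, (t v).2 : nat))).
have := forallP t_near (inord j, inord k); rewrite /node_pmf /= !inordK //.
have -> : #|[set v | ((t v).1 : nat, (t v).2 : nat) == (j, k)]| = #|[set v | t v == (inord j,
  inord k)]|.
  apply: eq_card => v; rewrite !inE [in RHS](surjective_pairing (t v)) !xpair_eqE.
  by rewrite -!val_eqE /= !inordK.
by [].
Qed.

Let edge_count_dev k j : (1 <= k <= K)%N -> (1 <= j <= J)%N ->
  `|(count_mem (k, j) et)%:R - m0%:R * Q k j| <= z / 4 * h * Q k j.
Proof.
move=> /andP[k0 kK] /andP[j0 jJ].
have kK' : (k.-1 < K)%N by rewrite prednK.
have jJ' : (j.-1 < J)%N by rewrite prednK.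
rewrite (count_map_enum (fun e => ((u e).1.+1, (u e).2.+1))).
have := forallP u_near (Ordinal kK', Ordinal jJ'); rewrite /edge_pmf /= !prednK //.
have -> : #|[set e | ((u e).1.+1, (u e).2.+1) == (k, j)]| = #|[set e | u e == (Ordinal kK',
  Ordinal jJ')]|.
  apply: eq_card => e; rewrite !inE [in RHS](surjective_pairing (u e)) !xpair_eqE.
  by rewrite -!val_eqE /= -[in LHS](prednK k0) -[in LHS](prednK j0) !eqSS.
by [].
Qed.

Let P_le1 j k : (j <= J)%N -> (k <= K)%N -> 0 <= P j k <= 1.
Proof.
move=> jJ kK; have [P0 P1] := distP.
have := P0 (inord j, inord k); rewrite /node_pmf /= !inordK // => -> /=.
rewrite -P1 (bigD1 (inord j, inord k)) //= {1}/node_pmf /= !inordK // lerDl.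
by rewrite sumr_ge0.
Qed.

Let Q_le1 k j : (1 <= k <= K)%N -> (1 <= j <= J)%N -> 0 <= Q k j <= 1.
Proof.
move=> /andP[k0 kK] /andP[j0 jJ]; have [Q0 Q1] := distQ.
have kK' : (k.-1 < K)%N by rewrite prednK.
have jJ' : (j.-1 < J)%N by rewrite prednK.
have := Q0 (Ordinal kK', Ordinal jJ'); rewrite /edge_pmf /= !prednK // => -> /=.
rewrite -Q1 (bigD1 (Ordinal kK', Ordinal jJ')) //= {1}/edge_pmf /= !prednK // lerDl.
by rewrite sumr_ge0.
Qed.

Let slack_le : (slack delta N)%:R <= h + 1.
Proof. by rewrite ltW // natceil_lt // powR_ge0. Qed.

Let reserve_le : (N - n1)%:R <= (4 + (maxn (J ^ 2) (K ^ 2))%:R) * h.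
Proof.
rewrite (reserve_size adm) natrD natrM.
have M0 : 0 <= (maxn (J ^ 2) (K ^ 2))%:R :> R by [].
have := ler_wpM2l M0 h_ge1; have := slack_le; have := h_ge1; lra.
Qed.

Let n1_le_N : (n1 <= N)%N.
Proof. by rewrite [leqRHS](reserveE adm) leq_addr. Qed.

Section Matched.
Variables (src tgt : {ffun 'I_(size ets) -> 'I_N}).
Hypothesis srcA : src \in allocations N (size ets) outs (unzip1 ets).
Hypothesis tgtA : tgt \in allocations N (size ets) ins (unzip2 ets).
Hypothesis few_bad : #|bad_edges src tgt|%:R <= h.
Local Notation g := (erased_graph src tgt).

Lemma node_error j k : (j <= J)%N -> (k <= K)%N ->
  `|(num_nodes g j k)%:R / N%:R - P j k| <= node_const * h / N%:R.
Proof.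
move=> jJ kK; have NR : 0 < N%:R :> R by rewrite ltr0n.
have -> : (num_nodes g j k)%:R / N%:R - P j k = ((num_nodes g j k)%:R - N%:R * P j k) / N%:R.
  by field; rewrite gt_eqF.
rewrite normrM [`|N%:R^-1|]ger0_norm ?invr_ge0 // ler_wpM2r ?invr_ge0 //.
have d1 := num_nodes_dev adm size_nt srcA tgtA j k.
have d2 := node_count_dev jJ kK.
have /andP[P0 P1] := P_le1 jJ kK.
have hP : h / 2 * P j k <= h / 2 by rewrite ler_piMr // divr_ge0 // powR_ge0.
have NP : N%:R * P j k = n1%:R * P j k + (N - n1)%:R * P j k.
  by rewrite -mulrDl -natrD subnKC.
have LP : 0 <= (N - n1)%:R * P j k <= (N - n1)%:R by rewrite mulr_ge0 //= ler_piMr.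
move: d1 d2; rewrite !ler_distl /node_const => /andP[? ?] /andP[? ?].
have := reserve_le; have := few_bad; have := h_ge1.
move: LP => /andP[? ?] ? ? ?.
apply/andP; split; lra.
Qed.

Let m0_ge : z * N%:R - z * node_const * h <= m0%:R.
Proof.
have /andP[m_ge _] := m0_bounds; apply: le_trans m_ge.
have NE : N%:R = n1%:R + (N - n1)%:R :> R by rewrite -natrD subnKC.
rewrite -mulrA -mulrBr ler_pM2l // /size2 natrD /node_const.
have s0 : 0 <= (slack delta N)%:R :> R by [].
have M0 : 0 <= (maxn (J ^ 2) (K ^ 2))%:R * h by rewrite mulr_ge0 // powR_ge0.
have := reserve_le; have := h_ge1; lra.
Qed.

(** This is the purpose of [h_small]: losses of order [h] leave at least half of about [z * N]
    edges, which controls the random denominator of the edge frequencies. *)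
Lemma card_erased_lower : z * N%:R / 2 <= #|g|%:R.
Proof.
have := card_erased_dev ntJK srcA tgtA; rewrite size_et ler_distl => /andP[lo _].
apply: le_trans lo; have := m0_ge; have := h_small; rewrite /edge_const.
have := ler_wpM2l (ler0n R (K + J)) few_bad.
have := ler_wpM2l (ler0n R (K ^ 2 + J ^ 2)) h_ge1.
have := ler_wpM2l (ler0n R (K + J)) h_ge1.
have := ler_wpM2l (ltW z_gt0) h_ge1.
have := ler0n R (K + J); have := ler0n R (K ^ 2 + J ^ 2); have := z_gt0.
lra.
Qed.

(** After multiplication by [#|g|] it remains to compare [num_edges] with [#|g| * Q k j]; both are
    close to [m0 * Q k j]. *)
Lemma edge_error k j : (1 <= k <= K)%N -> (1 <= j <= J)%N ->
  `|(num_edges g k j)%:R / #|g|%:R - Q k j| <= 2 * edge_const / z * h / N%:R.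
Proof.
move=> kK jJ; have NR : 0 < N%:R :> R by rewrite ltr0n.
have zN : 0 < z * N%:R / 2 by rewrite !mulr_gt0 // invr_gt0.
have gR : 0 < #|g|%:R :> R by exact: lt_le_trans card_erased_lower.
have -> : (num_edges g k j)%:R / #|g|%:R - Q k j = ((num_edges g k j)%:R - #|g|%:R * Q k j) /
  #|g|%:R.
  by field; rewrite gt_eqF.
rewrite normrM [`|#|g|%:R^-1|]ger0_norm ?invr_ge0 //.
apply: (@le_trans _ _ (edge_const * h / #|g|%:R)); last first.
  have e0 : 0 <= edge_const * h.
    by rewrite mulr_ge0 ?powR_ge0 // /edge_const !addr_ge0 ?mulr_ge0 // ltW.
  rewrite (_ : 2 * edge_const / z * h / N%:R = edge_const * h / (z * N%:R / 2)); last first.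
    by field; rewrite !gt_eqF.
  by rewrite ler_wpM2l // lef_pV2 ?posrE // card_erased_lower.
rewrite ler_wpM2r ?invr_ge0 //.
have d1 := num_edges_dev ntJK srcA tgtA k j.
have d2 := edge_count_dev kK jJ.
have d3 := card_erased_dev ntJK srcA tgtA; rewrite size_et in d3.
have /andP[Q0 Q1] := Q_le1 kK jJ.
have zh0 : 0 <= z * h by rewrite mulr_ge0 ?powR_ge0 // ltW.
have hQ : z / 4 * h * Q k j <= z * h.
  apply: (@le_trans _ _ (z / 4 * h)); last by lra.
  by rewrite ler_piMr // mulr_ge0 ?powR_ge0 // divr_ge0 // ltW.
have d4 : `|#|g|%:R * Q k j - m0%:R * Q k j|
    <= (K ^ 2 + J ^ 2)%:R + (K + J)%:R * #|bad_edges src tgt|%:R.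
  rewrite -mulrBl normrM (ger0_norm Q0); apply: le_trans d3; exact: ler_piMr.
move: d1 d2 d4; rewrite !ler_distl /edge_const => /andP[? ?] /andP[? ?] /andP[? ?].
have := ler_wpM2l (ler0n R (K + J)) few_bad.
have := ler_wpM2l (ler0n R (K ^ 2 + J ^ 2)) h_ge1.
by move=> ? ?; apply/andP; split; lra.
Qed.

Lemma type_error_le : type_error J K P Q g <= error_const * (h / N%:R).
Proof.
rewrite /type_error /error_const mulrDl lerD //.
  apply: (@le_trans _ _ (\sum_(j < J.+1) \sum_(k < K.+1) node_const * h / N%:R)).
    rewrite big_mkord; apply: ler_sum => j _; rewrite big_mkord; apply: ler_sum => k _.
    by apply: node_error; rewrite -ltnS.
  rewrite !sumr_const !card_ord -mulrnA -[leLHS]mulr_natl natrM mulnC.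
  by rewrite le_eqVlt; apply/orP; left; apply/eqP; rewrite natrM; ring.
apply: (@le_trans _ _ (\sum_(k < K) \sum_(j < J) 2 * edge_const / z * h / N%:R)).
  rewrite big_add1 big_mkord; apply: ler_sum => k _; rewrite big_add1 big_mkord;
    apply: ler_sum => j _.
  by apply: edge_error; rewrite /= ltn_ord.
rewrite !sumr_const !card_ord -mulrnA -[leLHS]mulr_natl mulnC.
by rewrite le_eqVlt; apply/orP; left; apply/eqP; ring.
Qed.
End Matched.

(** With at most [h] bad edges the error is at most [eps] for certain, so a larger error forces [h]
    bad edges. *)
Lemma prob_match_law_error (eps : R) : error_const * (h / N%:R) <= eps ->
  prob (@match_law R J K delta N nt et) (fun g => type_error J K P Q g > eps) <= bad_bound J K / h.
Proof.
move=> small; apply: (prob_match_law (P := P)) => //.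
- exact: near_balanced_out.
- exact: near_balanced_in.
- exact: lt_le_trans ltr01 h_ge1.
move=> src tgt srcA tgtA; apply: contraTT; rewrite -ltNge -leNgt => /ltW few.
exact: le_trans (type_error_le srcA tgtA few) small.
Qed.
End GraphError.

(** * Limits *)

Section Limits.
Context {R : realType}.

Lemma expectD (T : finType) (mu : T -> R) (f g : T -> R) :
  expect mu (fun x => f x + g x) = expect mu f + expect mu g.
Proof. by rewrite /expect -big_split; apply: eq_bigr => x _; rewrite mulrDr. Qed.

Lemma powR_unbounded (a M : R) : 0 < a -> (\forall N \near \oo, M <= N%:R `^ a)%classic.
Proof.
move=> a0; near=> N.
apply: (@le_trans _ _ (`|M| + 1)); first by rewrite (le_trans (ler_norm _)) ?lerDl.
rewrite -[leLHS]powRr1 ?addr_ge0 // -[X in _ `^ X](mulVf (lt0r_neq0 a0)) powRrM.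
rewrite ge0_ler_powR ?nnegrE ?powR_ge0 ?(ltW a0) //.
near: N; exact: nbhs_infty_ger.
Unshelve. all: by end_near. Qed.

Variables (J K : nat) (P Q : nat -> nat -> R) (delta : R).
Hypotheses (J_gt0 : (1 <= J)%N) (K_gt0 : (1 <= K)%N).
Hypothesis distP : is_dist (@node_pmf R J K P).
Hypothesis distQ : is_dist (@edge_pmf R J K Q).
Hypothesis z_gt0 : 0 < mean_deg J K P.
Hypothesis C1 : forall k : nat, (1 <= k <= K)%N ->
  q_out J Q k = k%:R * p_out J P k / mean_deg J K P.
Hypothesis C2 : forall j : nat, (1 <= j <= J)%N ->
  q_in K Q j = j%:R * p_in K P j / mean_deg J K P.
Hypotheses (delta_gt : 1 / 2 < delta) (delta_lt : delta < 1).
Local Notation z := (mean_deg J K P).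

Lemma is_dist_erased_law N : admissible J K delta N -> is_dist (@erased_law R J K P Q delta N).
Proof.
move=> adm; apply: is_dist_bind; first exact: is_dist_iid.
move=> t _; apply: is_dist_bind; first exact: is_dist_iid.
move=> u _ /=; case: ifP => [/andP[bal_out bal_in]|_]; last exact: is_dist_ret.
apply: (is_dist_match_law J_gt0 K_gt0 distP adm _ _ _ bal_out bal_in).
- by rewrite size_map size_enum_ord.
- exact: node_types_bounded.
- exact: edge_types_bounded.
Qed.

(** The terms stand for untypical node types, untypical edge types, and too many bad edges given
    typical types. Typical types being balanced, the fallback graph is covered by the first two. *)
Lemma prob_type_error_le N (eps : R) : admissible J K delta N ->
  1 <= N%:R `^ delta -> marginal_threshold J K P <= N%:R `^ delta ->
  (z * node_const J K + edge_const J K P) * N%:R `^ delta <= z * N%:R / 2 ->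
  error_const J K P * (N%:R `^ delta / N%:R) <= eps ->
  prob (@erased_law R J K P Q delta N) (fun g => type_error J K P Q g > eps)
  <= (size1 J K delta N)%:R / (N%:R `^ delta / 2) ^+ 2 * \sum_x (@node_pmf R J K P x)^-1
   + ((num_init J K P delta N)%:R / (z / 4 * N%:R `^ delta) ^+ 2
        * \sum_x (@edge_pmf R J K Q x)^-1
      + bad_bound J K / N%:R `^ delta).
Proof.
move=> adm h1 h_large h_small small; set h := N%:R `^ delta in h1 h_large h_small small *.
have h0 : 0 < h by exact: lt_le_trans h1.
have tau1 : 0 < h / 2 by rewrite divr_gt0.
have tau2 : 0 < z / 4 * h by rewrite mulr_gt0 // divr_gt0.
have dist_t := is_dist_iid (size1 J K delta N) distP.
have dist_u := is_dist_iid (num_init J K P delta N) distQ.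
have bound0 : 0 <= bad_bound J K / h :> R by rewrite divr_ge0 // ltW.
apply: le_trans (lerD (prob_not_near_mean _ distP tau1)
  (lerD (prob_not_near_mean (num_init J K P delta N) distQ tau2) (lexx _))).
rewrite prob_bind [X in _ <= X + _]prob_expect -[X in _ <= _ + X](expect_const _ dist_t) -expectD.
apply: ler_expect => [|t _]; first by case: dist_t.
rewrite prob_bind [X in _ <= _ + (X + _)]prob_expect.
rewrite -[X in _ <= _ + (_ + X)](expect_const _ dist_u) -expectD.
rewrite -[X in _ <= X + _](expect_const _ dist_u) -expectD.
apply: ler_expect => [|u _]; first by case: dist_u.
set nt := [seq _ | v <- enum 'I_(size1 _ _ _ _)].
set et := [seq _ | e <- enum 'I_(num_init _ _ _ _ _)].
have ntJK : all (fun x => (x.1 <= J) && (x.2 <= K))%N nt by exact: node_types_bounded.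
have etKJ : all (fun x => (1 <= x.1 <= K) && (1 <= x.2 <= J))%N et by exact: edge_types_bounded.
have size_nt : size nt = size1 J K delta N by rewrite size_map size_enum_ord.
have [t_near|_] /= := boolP (near_mean _ _ t); last first.
  apply: (@le_trans _ _ 1); last by rewrite lerDl addr_ge0.
  apply: prob_le1; case: ifP => [/andP[bal_out bal_in]|_]; last exact: is_dist_ret.
  exact: (is_dist_match_law J_gt0 K_gt0 distP adm).
have [u_near|_] /= := boolP (near_mean _ _ u); last first.
  apply: (@le_trans _ _ 1); last by rewrite add0r lerDl.
  apply: prob_le1; case: ifP => [/andP[bal_out bal_in]|_]; last exact: is_dist_ret.
  exact: (is_dist_match_law J_gt0 K_gt0 distP adm).
rewrite (near_balanced_out distP z_gt0 C1 h_large t_near u_near).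
rewrite (near_balanced_in distP z_gt0 C2 h_large t_near u_near) /= !add0r.
exact: (prob_match_law_error J_gt0 K_gt0 distP distQ z_gt0 C1 C2 adm h1).
Qed.

(** Coefficient of [N / h ^ 2] in the two Chebyshev bounds, at deviations [h / 2] and [z / 4 * h],
    with at most [N] nodes and [(z + 1) * N] edges. *)
Let deviation_const : R := 4 * \sum_x (@node_pmf R J K P x)^-1
  + 16 * (z + 1) / z ^+ 2 * \sum_x (@edge_pmf R J K Q x)^-1.

Lemma prob_type_error_cvg (eps : R) : 0 < eps ->
  (prob (@erased_law R J K P Q delta N) (fun g => type_error J K P Q g > eps)
     @[N --> admissible_oo J K delta] --> (0 : R))%classic.
Proof.
move=> eps0; apply/cvgr0Pnorm_le => eta eta0.
have d0 : 0 < delta by apply: lt_trans delta_gt; lra.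
have d1 : 0 < 1 - delta by rewrite subr_gt0.
have d2 : 0 < 2 * delta - 1 by move: delta_gt; lra.
rewrite /admissible_oo near_withinE; near=> N => adm.
rewrite ger0_norm; last by apply: prob_ge0; exact: is_dist_erased_law.
have N1 : 1 <= N%:R :> R by near: N; exact: nbhs_infty_ger.
have N0 : 0 < N%:R :> R by exact: lt_le_trans N1.
set h := N%:R `^ delta.
(* These are [w = N / h] and [v = h ^ 2 / N]. The first is unbounded because [delta < 1], which
   makes the error small; the second because [delta > 1 / 2], which makes Chebyshev's bounds
   small. *)
pose w : R := N%:R `^ (1 - delta); pose v : R := N%:R `^ (2 * delta - 1).
have hw : h * w = N%:R.
  rewrite /h /w -powRD; last by rewrite (gt_eqF N0) implybT.
  by rewrite addrC subrK powRr1 // ltW.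
have hv : h ^+ 2 = N%:R * v.
  rewrite /h /v -{2}(powRr1 (ltW N0)) expr2 -!powRD ?(gt_eqF N0) ?implybT //.
  by congr (_ `^ _); lra.
have h1 : 1 <= h by rewrite /h; near: N; exact: powR_unbounded.
have h_large : marginal_threshold J K P <= h by rewrite /h; near: N; exact: powR_unbounded.
have h_bad : 2 * bad_bound J K / eta <= h by rewrite /h; near: N; exact: powR_unbounded.
have w_large : 2 * (z * node_const J K + edge_const J K P) / z <= w.
  by rewrite /w; near: N; exact: powR_unbounded.
have w_eps : error_const J K P / eps <= w by rewrite /w; near: N; exact: powR_unbounded.
have v_large : 2 * deviation_const / eta <= v by rewrite /v; near: N; exact: powR_unbounded.
have h0 : 0 < h by exact: lt_le_trans h1.
have w0 : 0 < w by exact: powR_gt0.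
have v0 : 0 < v by exact: powR_gt0.
apply: le_trans (prob_type_error_le adm h1 h_large _ _) _.
- rewrite -/h -hw; move: w_large; rewrite ler_pdivrMr // => w_large.
  have := ler_wpM2l (ltW h0) w_large; lra.
- have -> : N%:R `^ delta / N%:R = w^-1 by rewrite -/h -hw invfM mulrA divff ?gt_eqF // mul1r.
  rewrite ler_pdivrMr // mulrC.
  by rewrite -ler_pdivrMr.
rewrite -/h addrA (_ : eta = eta / 2 + eta / 2); last by field.
have [P0 _] := distP; have [Q0 _] := distQ.
have SP0 : 0 <= \sum_x (@node_pmf R J K P x)^-1 by apply: sumr_ge0 => x _; rewrite invr_ge0.
have SQ0 : 0 <= \sum_x (@edge_pmf R J K Q x)^-1 by apply: sumr_ge0 => x _; rewrite invr_ge0.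
apply: lerD; last first.
  by move: h_bad; rewrite !ler_pdivrMr // => h_bad; lra.
apply: (@le_trans _ _ (deviation_const / v)); last first.
  by move: v_large; rewrite !ler_pdivrMr // => v_large; lra.
have n1N : (size1 J K delta N)%:R <= N%:R :> R by rewrite ler_nat leq_subr.
have m0N : (num_init J K P delta N)%:R <= (z + 1) * N%:R :> R.
  rewrite ltW // (lt_le_trans (natceil_lt _)) ?mulr_ge0 // ?(ltW z_gt0) // mulrDl mul1r lerD //.
  rewrite ler_pM2l // ler_nat [leqRHS](reserveE adm) /size2 leq_add2l mul2n -addnn -addnA
    leq_addr //.
rewrite /deviation_const mulrDl; apply: lerD.
  rewrite [leRHS]mulrAC ler_wpM2r // ler_pdivrMr ?exprn_gt0 ?divr_gt0 //.
  rewrite expr_div_n hv (_ : _ * _ = N%:R) //; by field; rewrite gt_eqF.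
rewrite [leRHS]mulrAC ler_wpM2r // ler_pdivrMr ?exprn_gt0 ?mulr_gt0 ?divr_gt0 //.
rewrite exprMn hv (_ : _ / v * _ = (z + 1) * N%:R) //; by field; rewrite !gt_eqF.
Unshelve. all: by end_near. Qed.

(** Closeness is asked for [eps < 1] only, because the empty graph, which has no edge to draw, is
    excluded only by an error below 1. *)
Lemma sample_cvg (s : nat) (T : nat -> finType) (T' : finType)
    (nu : forall N, digraph N -> T N -> R) (X : forall N, digraph N -> T N -> nat * nat)
    (lam : T' -> R) (Y : T' -> nat * nat) :
  (forall N, admissible J K delta N -> forall g, is_dist (nu N g)) ->
  is_dist lam -> injective Y ->
  (forall N (g : digraph N) (eps : R), eps < 1 -> type_error J K P Q g <= eps ->
     \sum_y `|prob (nu N g) (fun x => X N g x == Y y) - lam y| <= eps) ->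
  @cvg_in_distribution R (types s) (admissible_oo J K delta)
    (fun N => (digraph N * {ffun 'I_s -> T N})%type)
    (fun N => joint (@erased_law R J K P Q delta N) (fun g => iid s (nu N g)))
    (fun N w => (fun i : 'I_s => X N w.1 (w.2 i)))
    {ffun 'I_s -> T'} (iid s lam) (fun c => (fun i : 'I_s => Y (c i))).
Proof.
move=> nu_dist lam_dist Yinj close f _ [M fM].
have M0 : 0 <= M by apply: le_trans (fM (fun=> (0%N, 0%N))).
apply/cvgrPdist_le => eta eta0.
(* The total error is at most [2 * M * (s%:R + 1) * eps]; the summand 1 keeps [a] positive when [M]
   is 0, and the minimum with 1/2 keeps [eps] below 1. *)
pose a : R := 4 * M * (s%:R + 1) + 1.
have a1 : 1 <= a by rewrite lerDr !mulr_ge0.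
pose eps : R := Num.min (1 / 2) (eta / a).
have eps0 : 0 < eps by rewrite lt_min !divr_gt0 // (lt_le_trans ltr01).
have eps1 : eps < 1 by rewrite gt_min; apply/orP; left; lra.
have eps_a : a * eps <= eta.
  rewrite -ler_pdivlMl ?(lt_le_trans ltr01) // mulrC /eps ge_min lexx orbT //.
have /cvgr0Pnorm_le /(_ _ eps0) := prob_type_error_cvg eps0.
rewrite /admissible_oo !near_withinE; apply: filterS => N small adm.
have {small} := small adm; rewrite ger0_norm; last by apply: prob_ge0; exact: is_dist_erased_law.
move=> small; rewrite distrC.
apply: le_trans (joint_sample_distance (bad := fun g => eps < type_error J K P Q g)
  (f := f) (is_dist_erased_law adm) (nu_dist N adm) lam_dist Yinj M0 fM (ltW eps0) _) _.
  by move=> g; rewrite -leNgt; exact: close.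
apply: le_trans eps_a.
have Mp := ler_wpM2l M0 small.
have Me : 0 <= M * eps by rewrite mulr_ge0 // ltW.
have Mse : 0 <= M * (s%:R * eps) by rewrite !mulr_ge0 // ltW.
have ae : a * eps = 4 * (M * (s%:R * eps)) + 4 * (M * eps) + eps by rewrite /a; ring.
rewrite ae; lra.
Qed.

Lemma sum_types_nodes (F : nat -> nat -> R) :
  \sum_(0 <= j < J.+1) \sum_(0 <= k < K.+1) F j k
    = \sum_(x : 'I_J.+1 * 'I_K.+1) F x.1 x.2.
Proof.
rewrite -(pair_bigA _ (fun (j : 'I_J.+1) (k : 'I_K.+1) => F j k)) big_mkord.
by apply: eq_bigr => j _; rewrite big_mkord.
Qed.

Lemma sum_types_edges (F : nat -> nat -> R) :
  \sum_(1 <= k < K.+1) \sum_(1 <= j < J.+1) F k j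
    = \sum_(x : 'I_K * 'I_J) F x.1.+1 x.2.+1.
Proof.
rewrite -(pair_bigA _ (fun (k : 'I_K) (j : 'I_J) => F k.+1 j.+1)) big_add1 big_mkord.
by apply: eq_bigr => k _; rewrite big_add1 big_mkord.
Qed.

Lemma picked_node_error N (g : digraph N) (eps : R) : type_error J K P Q g <= eps ->
  \sum_(y : 'I_J.+1 * 'I_K.+1) `|prob (uniform [set: 'I_N])
      (fun v => node_type g v == (y.1 : nat, y.2 : nat)) - @node_pmf R J K P y| <= eps.
Proof.
move=> err.
have node_err : \sum_(x : 'I_J.+1 * 'I_K.+1)
    `|(num_nodes g x.1 x.2)%:R / N%:R - P x.1 x.2| <= eps.
  apply: le_trans err; rewrite /type_error sum_types_nodes lerDl.
  by rewrite sumr_ge0 // => j _; rewrite sumr_ge0.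
apply: le_trans node_err.
apply: ler_sum => y _; rewrite prob_expect expect_uniform_count cardsT card_ord.
rewrite (_ : [set _ in _ | _] = [set v | node_type g v == (y.1 : nat, y.2 : nat)]) //.
by apply/setP => v; rewrite !inE.
Qed.

Lemma sum_option (T : finType) (F : option T -> R) :
  \sum_o F o = F None + \sum_x F (Some x).
Proof.
rewrite (bigD1 None) //=; congr (_ + _).
rewrite (reindex_omap Some id) /=; last by case.
by apply: eq_bigl => x; rewrite eqxx.
Qed.

Lemma is_dist_pick_edge N (g : digraph N) : is_dist (@pick_edge R N g).
Proof.
split=> [[e|]|] /=; [exact: uniform_ge0 | exact: ler0n |].
rewrite sum_option /=.
have [->|g0] := eqVneq g finset.set0; last by have [_ ->] := is_dist_uniform g0 (R := R);
  rewrite add0r.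
by rewrite big1 ?addr0 // => e _; rewrite /uniform cards0 invr0 mulr0.
Qed.

(** On the empty graph all ratios are 0 and the edge part of the error is the total mass 1 of [Q].
    So [eps < 1] forces an edge to exist, and the type of a picked edge then follows the frequencies
    given by [num_edges]. *)
Lemma picked_edge_error N (g : digraph N) (eps : R) : eps < 1 ->
  type_error J K P Q g <= eps ->
  \sum_(y : 'I_K * 'I_J) `|prob (pick_edge g)
      (fun o => picked_type g o == (y.1.+1, y.2.+1)) - @edge_pmf R J K Q y| <= eps.
Proof.
move=> eps1 err.
have edge_err : \sum_(x : 'I_K * 'I_J)
    `|(num_edges g x.1.+1 x.2.+1)%:R / #|g|%:R - Q x.1.+1 x.2.+1| <= eps.
  apply: le_trans err; rewrite /type_error [X in _ <= _ + X]sum_types_edges lerDr.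
  by rewrite sumr_ge0 // => j _; rewrite sumr_ge0.
have g0 : g != finset.set0.
  apply: contraTneq edge_err => g0; rewrite -ltNge (lt_le_trans eps1) //.
  have [Q0 <-] := distQ; apply: ler_sum => x _.
  by rewrite g0 cards0 invr0 mulr0 sub0r normrN ger0_norm //; exact: Q0.
apply: le_trans edge_err; apply: ler_sum => y _.
rewrite prob_expect /expect sum_option /= (negPf g0) mul0r add0r.
have := expect_uniform_count g (fun e => edge_type g e == (y.1.+1, y.2.+1)) (R := R).
by rewrite /expect => ->.
Qed.
End Limits.

Local Open Scope classical_set_scope.

Theorem theorem2p5 (R : realType) (J K : nat) (P Q : nat -> nat -> R)
    (delta : R)
    (J_ge1 : (1 <= J)%N) (K_ge1 : (1 <= K)%N)
    (distP : is_dist (@node_pmf R J K P))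
    (distQ : is_dist (@edge_pmf R J K Q))
    (z_gt0 : 0 < mean_deg J K P)
    (C1 : forall k : nat, (1 <= k <= K)%N ->
       q_out J Q k = k%:R * p_out J P k / mean_deg J K P)
    (C2 : forall j : nat, (1 <= j <= J)%N ->
       q_in K Q j = j%:R * p_in K P j / mean_deg J K P)
    (delta_gt : 1 / 2 < delta) (delta_lt : delta < 1) :
  (forall s : nat,
     @cvg_in_distribution R (types s) (admissible_oo J K delta)
       (fun N => (digraph N * {ffun 'I_s -> 'I_N})%type)
       (fun N => @node_sample R J K P Q delta N s)
       (fun N w => (fun i : 'I_s => node_type w.1 (w.2 i)))
       {ffun 'I_s -> 'I_J.+1 * 'I_K.+1}
       (iid s (@node_pmf R J K P))
       (fun c => (fun i : 'I_s => ((c i).1 : nat, (c i).2 : nat)))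
   /\
     @cvg_in_distribution R (types s) (admissible_oo J K delta)
       (fun N => (digraph N * {ffun 'I_s -> option ('I_N * 'I_N)})%type)
       (fun N => @edge_sample R J K P Q delta N s)
       (fun N w => (fun i : 'I_s => picked_type w.1 (w.2 i)))
       {ffun 'I_s -> 'I_K * 'I_J}
       (iid s (@edge_pmf R J K Q))
       (fun c => (fun i : 'I_s => ((c i).1.+1, (c i).2.+1))))
  /\
  (forall eps : R, 0 < eps ->
     prob (@erased_law R J K P Q delta N) (fun g =>
         (\sum_(0 <= j < J.+1) \sum_(0 <= k < K.+1)
            `|(num_nodes g j k)%:R / N%:R - P j k|
          + \sum_(1 <= k < K.+1) \sum_(1 <= j < J.+1)
            `|(num_edges g k j)%:R / #|g|%:R - Q k j|) > eps)
       @[N --> admissible_oo J K delta] --> (0 : R)).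
Proof.
split=> [s|eps eps0]; last exact: (prob_type_error_cvg J_ge1 K_ge1 distP distQ z_gt0 C1 C2).
split.
- apply: (sample_cvg J_ge1 K_ge1 distP distQ z_gt0 C1 C2 delta_gt delta_lt
    (nu := fun N _ => uniform (finset.setTfor 'I_N)) (X := fun N g v => node_type g v)
    (Y := fun y : 'I_J.+1 * 'I_K.+1 => (y.1 : nat, y.2 : nat))) => //.
  + move=> N adm g; apply: is_dist_uniform; rewrite -card_gt0 cardsT card_ord.
    by rewrite (reserveE adm) ltn_addr // (size1_gt0 adm).
  + by move=> [a b] [c d] /= [/val_inj -> /val_inj ->].
  + by move=> N g eps _; exact: picked_node_error.
- apply: (sample_cvg J_ge1 K_ge1 distP distQ z_gt0 C1 C2 delta_gt delta_lt
    (nu := fun N g => pick_edge g) (X := fun N g o => picked_type g o)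
    (Y := fun y : 'I_K * 'I_J => (y.1.+1, y.2.+1))) => //.
  + by move=> N _ g; exact: is_dist_pick_edge.
  + by move=> [a b] [c d] /= [/val_inj -> /val_inj ->].
  + by move=> N g eps; exact: picked_edge_error.
Qed.
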